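(* Let $q_0\in[1/2,1)$ and consider the invariant Galton-Watson measure $\mathcal{IGW}(q_0)$. Put $c=\frac{1}{1-q_0}$. Then the order distribution is $$\pi_i=q_0\,c^{1-i},\qquad i\ge 1.$$ The measure satisfies the Toeplitz property, with regular Tokunaga coefficients $$T^o_{i,j}=T^o_{j-i},\qquad T^o_k=c^{k-1}\quad(k=1,2,\dots),$$ and Tokunaga coefficients $$T_{i,j}=T_{j-i},\qquad T_1=c^{c/(c-1)}-c-1,\qquad T_k=a\,c^{k-1}\quad(k=2,3,\dots),$$ where $a=(c-1)\left(c^{1/(c-1)}-1\right)$. Finally, the strong Horton law for mean branch numbers holds with Horton exponent $R=c^{c/(c-1)}=(1-q_0)^{-1/q_0}$.
   Context: Trees and Galton-Watson measures. $\mathcal{T}^|$ denotes the set of finite unlabeled rooted trees that are planted (either the empty tree $\phi$ consisting of the root only, or the root has exactly one offspring) and reduced (no vertex of degree $2$). For a probability distribution $\{q_k\}_{k\ge 0}$ with $q_1=0$, $\mathcal{GW}(\{q_k\})$ is the law of the random tree whose root has a single offspring and in which every non-root vertex independently has $k$ offspring with probability $q_k$. It is critical if $\sum_k kq_k=1$. For $q\in[1/2,1)$, $\mathcal{IGW}(q)$ is the critical Galton-Watson measure whose offspring generating function is $Q(z)=\sum_m q_mz^m=z+q(1-z)^{1/q}$ (so the probability of no offspring is $q$). Horton pruning and orders. $\mathcal{R}(T)$ for $T\neq\phi$ is obtained from $T$ by removing all leaves together with their parental edges, followed by series reduction (removing each non-root vertex of degree $2$ and merging its two adjacent edges); $\mathcal{R}(\phi)=\phi$.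 The Horton-Strahler order is $\mathrm{ord}(T)=\min\{k\ge0:\mathcal{R}^k(T)=\phi\}$. For a random tree $T$ with law $\mu$, $\pi_i=P(\mathrm{ord}(T)=i)$. For a non-root vertex $v$, $\mathrm{ord}(v)=\mathrm{ord}(T_v)$, where $T_v$ is the planted subtree rooted at the parent of $v$ and consisting of $v$, all its descendants and their parental edges; the root has order $\mathrm{ord}(T)$; the parental edge of a non-root vertex has the order of that vertex. A branch is a maximal connected component consisting of vertices and edges of the same order; its terminal vertex is its vertex farthest from the root. Tokunaga coefficients. For a tree $T$ and $1\le i<j$: $N_j$ is the number of branches of order $j$; $n_{i,j}$ is the number of vertices of order $i$ whose parent has order $j$; $n^o_{i,j}$ is the number of vertices of order $i$ whose parent is a non-terminal vertex of order $j$ (non-terminal in its branch). Let $\mathsf{E}_K$ be expectation under $\mu$ conditioned on $\mathrm{ord}(T)=K$. For $1\le i<j\le K$, $$T_{i,j}[K]=\frac{\mathsf{E}_K[n_{i,j}]}{\mathsf{E}_K[N_j]}-2\delta_{i,j-1},\qquad T^o_{i,j}[K]=\frac{\mathsf{E}_K[n^o_{i,j}]}{\mathsf{E}_K[N_j]}.$$ For critical and subcritical Galton-Watson measures these do not depend on $K\ge j$; the common values are denoted $T_{i,j}$ (Tokunaga coefficients) and $T^o_{i,j}$ (regular Tokunaga coefficients). The measure satisfies the Toeplitz property if there is a sequence $T_k\ge0$, $k\ge1$, with $T_{i,j}=T_{j-i}$ for all $1\le i<j$. Strong Horton law for mean branch numbers with Horton exponent $R\ge2$: for every $k\ge1$,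 $\lim_{K\to\infty}\mathsf{E}_K[N_k]/\mathsf{E}_K[N_1]=R^{1-k}$. *)

(* Defs.v *)
From HB Require Import structures.
From mathcomp Require Import all_boot all_order perm all_algebra.
From mathcomp Require Import all_classical all_reals all_analysis.

Set Implicit Arguments.
Unset Strict Implicit.
Unset Printing Implicit Defensive.

Import Order.TTheory GRing.Theory Num.Theory.
Import numFieldNormedType.Exports.

Local Open Scope nat_scope.

Inductive tree := Node of seq tree.

Definition children (t : tree) : seq tree := let: Node ts := t in ts.

(* The tree reduced to its root, which plays the role of the empty tree. *)
Definition phi : tree := Node [::].

Fixpoint tree_nested_ind (P : tree -> Prop)
    (IH : forall ts, (forall n, n < size ts -> P (nth phi ts n)) -> P (Node ts))
    (t : tree) : P t :=
  let: Node ts := t in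
  IH ts ((fix loop us : forall n, n < size us -> P (nth phi us n) :=
    match us with
    | [::] => fun n (h : n < 0) => False_ind _ (notF h)
    | u :: us' => fun n =>
        match n with
        | 0 => fun _ => tree_nested_ind IH u
        | n'.+1 => fun h => loop us' n' h
        end
    end) ts).

Fixpoint tree_encode (t : tree) : GenTree.tree unit :=
  let: Node ts := t in GenTree.Node 0 (map tree_encode ts).

Fixpoint tree_decode (g : GenTree.tree unit) : tree :=
  if g is GenTree.Node _ gs then Node (map tree_decode gs) else phi.

Lemma tree_encodeK : cancel tree_encode tree_decode.
Proof.
elim/tree_nested_ind => ts IH /=; congr Node.
rewrite -map_comp; apply: (@eq_from_nth _ phi); rewrite size_map // => n ltn.
by rewrite (nth_map phi) //= IH.
Qed.

HB.instance Definition _ := Countable.copy tree (can_type tree_encodeK).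

(* A vertex is addressed by the positions of the successive children met on
   its path from the root, the last one first: the root is [::], and the parent
   of i :: u is u. *)
Fixpoint vertices (t : tree) : seq (seq nat) :=
  let: Node ts := t in
  [::] :: flatten [seq [seq rcons v p.1 | v <- p.2]
                  | p <- zip (iota 0 (size ts)) (map vertices ts)].

Definition subtree (t : tree) (v : seq nat) : tree :=
  foldr (fun i s => nth phi (children s) i) t v.

Definition is_root (v : seq nat) : bool := v == [::].

Definition parent (u v : seq nat) : bool :=
  if v is _ :: w then u == w else false.

Definition offspring (t : tree) (v : seq nat) : nat :=
  size (children (subtree t v)).

Definition planted (t : tree) : bool := offspring t [::] <= 1.

Definition reduced (t : tree) : bool :=
  all (fun v => is_root v || (offspring t v != 1)) (vertices t).

(* Isomorphism of rooted trees: the subtrees of the root are isomorphic up to a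
   permutation. *)
Inductive iso : tree -> tree -> Prop :=
| Iso n ss ts (s : {perm 'I_n}) :
    size ss = n -> size ts = n ->
    (forall i : 'I_n, iso (nth phi ss i) (nth phi ts (s i))) ->
    iso (Node ss) (Node ts).

Lemma iso_inv x y : iso x y ->
  exists n (s : {perm 'I_n}),
    [/\ size (children x) = n, size (children y) = n &
     forall i : 'I_n, iso (nth phi (children x) i) (nth phi (children y) (s i))].
Proof. by case=> n ss ts s *; exists n, s. Qed.

Lemma iso_refl x : iso x x.
Proof.
elim/tree_nested_ind: x => ss IH.
apply: (@Iso (size ss) ss ss 1%g) => // i; rewrite perm1; exact: IH.
Qed.

Lemma iso_sym x y : iso x y -> iso y x.
Proof.
elim/tree_nested_ind: x y => ss IH [ts] /iso_inv[n [s /= [zs zt h]]].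
apply: (@Iso n ts ss s^-1%g) => // i; apply: IH; first by rewrite zs.
by have := h (s^-1%g i); rewrite permKV.
Qed.

Lemma iso_trans x y z : iso x y -> iso y z -> iso x z.
Proof.
elim/tree_nested_ind: x y z => ss IH [ts] [us].
move=> /iso_inv[n [s /= [zs zt h]]] /iso_inv[m [s' /= [zt' zu h']]].
have e : n = m by rewrite -zt zt'.
move: s' zt' zu h'; rewrite -{m}e => s' _ zu h'.
apply: (@Iso n ss us (s * s')%g) => // i; rewrite permM.
by apply: IH (h i) (h' (s i)); rewrite zs.
Qed.

Definition ptree := {t : tree | planted t && reduced t}.

Definition isob (x y : ptree) : bool := `[< iso (val x) (val y) >].

Lemma isob_refl : reflexive isob.
Proof. by move=> x; apply/asboolP; exact: iso_refl. Qed.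

Lemma isob_sym : symmetric isob.
Proof. by move=> x y; apply/asboolP/asboolP; exact: iso_sym. Qed.

Lemma isob_trans : transitive isob.
Proof.
by move=> y x z /asboolP xy /asboolP yz; apply/asboolP; exact: iso_trans yz.
Qed.

Canonical isob_equiv := EquivRel isob isob_refl isob_sym isob_trans.

Definition utree := {eq_quot isob}%qT.

HB.instance Definition _ := Choice.on utree.
HB.instance Definition _ := EqQuotient.on utree.

(* Isomorphism invariants are evaluated on a representative. *)
Definition tree_of (x : utree) : tree := val (repr x).
Coercion tree_of : utree >-> tree.

(* The recursion acts on the children that are not leaves, so the root of t is
   always kept. *)
Fixpoint cut_leaves (t : tree) : tree :=
  let: Node ts := t in
  Node (pmap (fun s => if s is Node [::] then None else Some (cut_leaves s)) ts).

(* Series reduction of a tree hanging below a parent, so that a vertex with a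
   single child, its root included, has degree 2. *)
Fixpoint suppress (t : tree) : tree :=
  let: Node ts := t in
  let ts' := map suppress ts in
  if ts' is [:: s] then s else Node ts'.

Definition series_reduction (t : tree) : tree := Node (map suppress (children t)).

Definition prune (t : tree) : tree := series_reduction (cut_leaves t).

Fixpoint nvertices (t : tree) : nat :=
  let: Node ts := t in (sumn (map nvertices ts)).+1.

Lemma nvertices_suppress t : nvertices (suppress t) <= nvertices t.
Proof.
elim/tree_nested_ind: t => ts IH /=.
have h : sumn (map nvertices (map suppress ts)) <= sumn (map nvertices ts).
  elim: ts IH => //= s ts IHts IH; apply: leq_add; first exact: (IH 0).
  by apply: IHts => n; exact: (IH n.+1).
case: (map suppress ts) h => [|s [|s' us]] //=; rewrite ?addn0 => h.
exact: leqW.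
Qed.

Lemma nvertices_cut t : nvertices (cut_leaves t) <= nvertices t.
Proof.
elim/tree_nested_ind: t => ts IH /=; rewrite ltnS.
elim: ts IH => //= s ts IHts IH.
have {IHts} h := IHts (fun n => IH n.+1).
case: s IH => -[|s us] IH /=; first by rewrite (leq_trans h) // leq_addl.
by apply: leq_add h; exact: (IH 0).
Qed.

Lemma nvertices_cut_lt t : t != phi -> nvertices (cut_leaves t) < nvertices t.
Proof.
elim/tree_nested_ind: t => ts IH; case: ts IH => // s ts IH _ /=; rewrite ltnS.
have h : nvertices (cut_leaves (Node ts)) <= nvertices (Node ts).
  exact: nvertices_cut.
rewrite /= ltnS in h.
case: s IH => -[|s us] IH; first by rewrite /= add1n ltnS.
have ns0 : Node (s :: us) != phi by apply/eqP.
exact: (leq_add (IH 0 isT ns0) h).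
Qed.

Lemma nvertices_prune t : t != phi -> nvertices (prune t) < nvertices t.
Proof.
move=> tn0; apply: leq_ltn_trans (nvertices_cut_lt tn0).
rewrite /prune; case: (cut_leaves t) => ts; rewrite /series_reduction /= ltnS.
by elim: ts => //= s ts IH; apply: leq_add => //; exact: nvertices_suppress.
Qed.

Lemma prune_phi t : exists k, iter k prune t == phi.
Proof.
have [n] := ubnP (nvertices t); elim: n t => // n IH t ltn.
have [->|tn0] := eqVneq t phi; first by exists 0.
have [|k hk] := IH (prune t); first exact: leq_trans (nvertices_prune tn0) _.
by exists k.+1; rewrite iterSr.
Qed.

Definition ord (t : tree) : nat := ex_minn (prune_phi t).

(* For v not the root, this is the order of the planted tree made of the parent
   of v, v and the descendants of v. *)
Definition vord (t : tree) (v : seq nat) : nat :=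
  if is_root v then ord t else ord (Node [:: subtree t v]).

Section Branches.
Variable t : tree.

Definition vertex := seq_sub (vertices t).

(* The edge between v and its parent has the order of v; it lies in the same
   branch as both of its ends when these have the same order. *)
Definition same_branch_edge : rel vertex := fun u v =>
  (vord t (val u) == vord t (val v)) &&
  (parent (val u) (val v) || parent (val v) (val u)).

Definition num_branches (j : nat) : nat :=
  n_comp same_branch_edge [pred v : vertex | vord t (val v) == j].

Definition terminal (v : vertex) : bool :=
  [forall w : vertex,
     connect same_branch_edge v w ==> (size (val w) <= size (val v))].

(* n_{i,j}: all vertices of order i with a parent of order j are counted, also
   those merging at the terminal vertex of a branch. *)
Definition num_side (i j : nat) : nat :=
  #|[set v : vertex | (vord t (val v) == i) &&
      [exists u : vertex, parent (val u) (val v) && (vord t (val u) == j)]]|.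

(* n^o_{i,j} *)
Definition num_side_regular (i j : nat) : nat :=
  #|[set v : vertex | (vord t (val v) == i) &&
      [exists u : vertex, [&& parent (val u) (val v),
                              vord t (val u) == j & ~~ terminal u]]]|.

End Branches.

Local Open Scope classical_set_scope.
Local Open Scope ring_scope.

Section Laws.
Variable R : realType.

(* The root has one offspring almost surely, so that phi has probability 0. *)
Definition planar_gw (q : nat -> R) (t : tree) : R :=
  (offspring t [::] == 1%N)%:R *
  \prod_(v <- vertices t | ~~ is_root v) q (offspring t v).

(* The image of the law on plane trees under the projection to unlabeled trees.
   Laws on the countable type utree are given by their mass functions. *)
Definition GW (q : nat -> R) (x : utree) : \bar R :=
  \esum_(t in [set t : ptree | \pi_utree%qT t = x]) (planar_gw q (val t))%:E.

Definition offspring_distribution (q : nat -> R) : Prop :=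
  [/\ forall k, 0 <= q k, q 1%N = 0 & series q @ \oo --> (1 : R)].

Definition critical (q : nat -> R) : Prop :=
  series (fun k => k%:R * q k) @ \oo --> (1 : R).

Definition generating_function (q : nat -> R) (Q : R -> R) : Prop :=
  forall z, 0 <= z <= 1 -> series (fun m => q m * z ^+ m) @ \oo --> Q z.

(* The values of the generating function on [0, 1] determine q, hence mu. *)
Definition IGW (q0 : R) (mu : utree -> \bar R) : Prop :=
  exists q : nat -> R,
    [/\ offspring_distribution q, critical q,
        generating_function q (fun z => z + q0 * (1 - z) `^ q0^-1) &
        mu = GW q].

Section Law.
Variable mu : utree -> \bar R.

Local Open Scope ereal_scope.

Definition order_prob (i : nat) : \bar R :=
  \esum_(x in [set x : utree | ord x = i]) mu x.

Definition cond_mean (K : nat) (f : tree -> nat) : \bar R :=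
  (\esum_(x in [set x : utree | ord x = K]) ((f (x : utree))%:R%:E * mu x))
    / order_prob K.

Definition tokunaga_ratio (K i j : nat) : \bar R :=
  cond_mean K (fun t => num_side t i j) /
  cond_mean K (fun t => num_branches t j) - (2 * (i == j.-1)%:R)%:E.

Definition regular_tokunaga_ratio (K i j : nat) : \bar R :=
  cond_mean K (fun t => num_side_regular t i j) /
  cond_mean K (fun t => num_branches t j).

(* T_{i,j}[K] = x for all K >= j, i.e. T_{i,j} is well defined, equal to x. *)
Definition tokunaga_coef (i j : nat) (x : R) : Prop :=
  forall K, (j <= K)%N -> tokunaga_ratio K i j = x%:E.

Definition regular_tokunaga_coef (i j : nat) (x : R) : Prop :=
  forall K, (j <= K)%N -> regular_tokunaga_ratio K i j = x%:E.

Definition toeplitz : Prop :=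
  exists T : nat -> R, (forall k, (1 <= k)%N -> (0 <= T k)%R) /\
    forall i j, (1 <= i < j)%N -> tokunaga_coef i j (T (j - i)%N).

Definition strong_horton (r : R) : Prop :=
  (2 <= r)%R /\
  forall k, (1 <= k)%N ->
    (fun K => cond_mean K (fun t => num_branches t k) /
              cond_mean K (fun t => num_branches t 1)) @ \oo
      --> (r ^- k.-1)%:E.

End Law.
End Laws.

(* Main.v *)
Require Import Defs.
From mathcomp Require Import all_boot all_order all_algebra perm.
From mathcomp Require Import zify ring lra.
From mathcomp Require Import all_classical all_reals all_analysis.
Import Order.TTheory GRing.Theory Num.Theory.
Import numFieldNormedType.Exports.

(** The proof rests on three observations.

Counts are additive.  On a plane tree whose vertices never have exactly one
offspring, pruning acts on each vertex separately, so that the order of a vertex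
is a symmetric function merge_order of the orders of its children (ord_planted).
A branch is a descending path with a single lowest vertex, hence N_j, n_(i,j) and
the regular n_(i,j) are all of the form tally h: the sum over the vertices u of a
quantity h that depends only on the orders of u and of its children, and that
vanishes unless u has order j (num_branches_tally, num_side_tally,
num_side_regular_tally).  For N_j, h is the indicator of a vertex of order j
without a child of order j.  Such functions are invariant under isomorphism, so
expectations over unlabeled trees become sums over plane trees (esum_GW).

One recursion covers orders and counts.  A vertex has order at most K+1 iff all
children have order at most K, or exactly one has order K+1 and the others at
most K (order_le_children).  Let Q be the offspring generating function and
sigma_K = P(order <= K).  Summing over the children gives
  sigma_(K+1) = Q(sigma_K) + pi_(K+1) Q'(sigma_K).
For Q(z) = z + q0 (1 - z)^(1/q0) this forces 1 - sigma_K = c^(-K) (gw_order).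
With rho = c^(1/(c-1)) one gets 1 - Q'(sigma_K) = rho^(-K) and
pi_(K+1) Q''(sigma_K) = rho^(-K) / c.  If H is the mean of h and G_K the mean of
tally h on trees of order at most K, the Leibniz rule for an additive functional
gives, as soon as K + 1 >= j,
  G_(K+1) = H + Q'(sigma_K) G_(K+1) + pi_(K+1) Q''(sigma_K) G_K,
that is G_(K+1) = H rho^K + G_K / c (gw_additive).

The ratios follow.  The factor of H in G_K - G_(K-1) depends on j and K only.
Therefore every ratio of conditional means given order K is a ratio of two means
H, whatever K >= j is (cond_mean_ratio); these are read off from Q, Q' and Q''
(gw_branch_end, gw_side_children, gw_children) and yield the Tokunaga
coefficients.  Solving the recursion for N_j, where H = q0 (c rho)^(-(j-1)),
shows that E_K[N_j] is proportional to
  (c rho)^(-(j-1)) (c rho - c) + (c - 1) (c rho)^(-(K-1))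
with a factor free of j; since rho > 1 this gives the strong Horton law with
exponent R = c rho = c^(c/(c-1)). *)

Set Implicit Arguments.
Unset Strict Implicit.
Unset Printing Implicit Defensive.

Local Open Scope nat_scope.

(** * Addresses of vertices *)

Lemma subtree_rcons t u k : subtree t (rcons u k) = subtree (nth phi (children t) k) u.
Proof. by rewrite /subtree foldr_rcons. Qed.

Lemma offspring_rcons t u k :
  offspring t (rcons u k) = offspring (nth phi (children t) k) u.
Proof. by rewrite /offspring subtree_rcons. Qed.

Lemma verticesE ts : vertices (Node ts) =
  [::] :: flatten [seq [seq rcons v k | v <- vertices (nth phi ts k)]
                  | k <- iota 0 (size ts)].
Proof.
rewrite /=; congr (_ :: flatten _).
apply: (@eq_from_nth _ [::]).
  by rewrite !size_map size_zip size_iota size_map minnn.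
move=> k; rewrite size_map size_zip size_iota size_map minnn => lk.
rewrite (nth_map (0, [::])) ?size_zip ?size_iota ?size_map ?minnn //.
rewrite nth_zip ?size_iota ?size_map //= (nth_map 0) ?size_iota //.
by rewrite nth_iota // (nth_map phi).
Qed.

Lemma nil_vertices t : [::] \in vertices t.
Proof. by case: t. Qed.

Lemma rcons_vertices t v k : (rcons v k \in vertices t) =
  (k < size (children t)) && (v \in vertices (nth phi (children t) k)).
Proof.
case: t => ts; rewrite verticesE /children inE.
rewrite -size_eq0 size_rcons /=.
apply/flatten_mapP/andP => [[l]|[lk vk]].
  rewrite mem_iota add0n => /andP[_ ll] /mapP[w wl /rcons_inj[-> ->]].
  by rewrite ll.
by exists k; [rewrite mem_iota | apply: map_f].
Qed.

Lemma cons_vertices t v k : (k :: v \in vertices t) =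
  (v \in vertices t) && (k < offspring t v).
Proof.
elim/last_ind: v t => [|v l IH] t.
  by rewrite -[[:: k]]/(rcons [::] k) rcons_vertices !nil_vertices andbT.
rewrite -rcons_cons !rcons_vertices IH offspring_rcons.
by rewrite andbA.
Qed.

Lemma uniq_vertices t : uniq (vertices t).
Proof.
elim/tree_nested_ind: t => ts IH; rewrite verticesE cons_uniq; apply/andP; split.
  by apply/negP => /flatten_mapP[k _ /mapP[w _ /(congr1 size)]]; rewrite size_rcons.
have : forall k, k \in iota 0 (size ts) -> uniq (vertices (nth phi ts k)).
  by move=> k; rewrite mem_iota; apply: IH.
elim: (iota 0 _) (iota_uniq 0 (size ts)) => //= k s IHs /andP[ks us] h.
rewrite cat_uniq map_inj_uniq ?h ?mem_head //=; last by move=> u v /rcons_inj[].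
rewrite IHs // ?andbT; last by move=> l ls; apply: h; rewrite inE ls orbT.
apply/hasPn => w /flatten_mapP[l ls /mapP[v _ ->]].
by apply/mapP => -[v' _ /rcons_inj[_ lk]]; rewrite -lk ls in ks.
Qed.

Lemma big_vertices (T : Type) (idx : T) (op : Monoid.law idx) ts F :
  \big[op/idx]_(v <- vertices (Node ts)) F v = op (F [::])
  (\big[op/idx]_(k <- iota 0 (size ts))
    \big[op/idx]_(v <- vertices (nth phi ts k)) F (rcons v k)).
Proof.
rewrite verticesE big_cons big_flatten big_map; congr (op _ _).
by apply: eq_bigr => k _; rewrite big_map.
Qed.

(** Every vertex other than the root is met once as a child of its parent. *)
Lemma sum_vertices_by_parent t (F : seq nat -> nat) :
  \sum_(v <- vertices t) F v =
  F [::] + \sum_(u <- vertices t) \sum_(0 <= k < offspring t u) F (k :: u).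
Proof.
elim/tree_nested_ind: t F => ts IH F; rewrite !big_vertices /=.
congr addn; rewrite /index_iota subn0 -big_split /= big_seq [RHS]big_seq.
apply: eq_bigr => k; rewrite mem_iota => /IH -> /=; congr addn.
by apply: eq_bigr => u _; rewrite offspring_rcons.
Qed.

(** * Horton-Strahler orders *)

(** A leaf gets order 1, because the maximum of no orders is 0 and is attained by
no child. *)
Definition merge_order (ns : seq nat) : nat :=
  let m := \max_(n <- ns) n in if count_mem m ns == 1 then m else m.+1.

Fixpoint order (t : tree) : nat := let: Node ts := t in merge_order (map order ts).

Fixpoint branching (t : tree) : bool :=
  let: Node ts := t in (size ts != 1) && all branching ts.

Lemma leq_bigmax_seq_mem (ns : seq nat) n : n \in ns -> n <= \max_(m <- ns) m.
Proof. by move=> h; apply: (@leq_bigmax_seq _ ns xpredT id). Qed.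

(** The two ways to stay below K+1: the maximum is at most K, or it is K+1 and is
attained once.  Both are conditions on how many entries exceed K and K+1. *)
Lemma merge_order_leS ns K : (merge_order ns <= K.+1) =
  (count (fun n => K < n) ns == 0) ||
  (count (fun n => K < n) ns == 1) && (count (fun n => K.+1 < n) ns == 0).
Proof.
rewrite /merge_order; set m := \max_(n <- ns) n.
have mP n : n \in ns -> n <= m by apply: leq_bigmax_seq_mem.
have mw : ns != [::] -> m \in ns.
  rewrite /m; elim: ns {m mP} => //= n [|n' ns] IH _.
    by rewrite big_seq1 mem_head.
  rewrite big_cons /maxn; case: ifP => _; last by rewrite mem_head.
  by rewrite in_cons IH ?orbT.
have cz L : (count (fun n => L < n) ns == 0) = (m <= L).
  apply/idP/idP => [|mL].
    rewrite -leqn0 leqNgt -has_count -all_predC => /allP h.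
    case: (eqVneq ns [::]) => [e|/mw /h /=]; last by rewrite -leqNgt.
    by rewrite /m e big_nil.
  rewrite -leqn0 leqNgt -has_count -all_predC; apply/allP => n /mP nm /=.
  by rewrite -leqNgt (leq_trans nm).
rewrite !cz; case: (ltngtP m K.+1) => [|mK|mK].
- by rewrite ltnS => mK; rewrite mK /=; case: ifP => _; lia.
- have -> : (m <= K) = false by lia.
  by rewrite andbF /=; case: ifP => _; lia.
- have -> : (m <= K) = false by lia.
  rewrite andbT /= mK.
  have -> : count (fun n => K < n) ns = count_mem K.+1 ns.
    by apply: eq_in_count => n /mP /=; rewrite mK; case: ltngtP => //; lia.
  by case: ifP => _; rewrite ?leqnn // ltnn.
Qed.

Lemma merge_order_gt0 ns : 0 \notin ns -> 0 < merge_order ns.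
Proof.
rewrite /merge_order => h; case: ifP => // /eqP c1; rewrite lt0n; apply/eqP => m0.
by move: h; rewrite -has_pred1 has_count; rewrite m0 in c1; rewrite c1.
Qed.

Lemma order_gt0 t : 0 < order t.
Proof.
elim/tree_nested_ind: t => ts IH /=; apply: merge_order_gt0.
apply/mapP => -[s /(nthP phi)[k lk <-]] h.
by have := IH k lk; rewrite -h.
Qed.

Lemma merge_order_ge ns n : n \in ns -> n <= merge_order ns.
Proof.
move=> h; apply: (leq_trans (leq_bigmax_seq_mem h)).
by rewrite /merge_order; case: ifP.
Qed.

(** A repeated maximum raises the order, so at most one child shares the order of
its parent; this is what makes branches unbranched. *)
Lemma merge_order_uniq ns : count_mem (merge_order ns) ns <= 1.
Proof.
rewrite {1}/merge_order; case: ifP => [/eqP -> //|_].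
rewrite leqNgt; apply/negP => h.
have /leq_bigmax_seq_mem : (\max_(n <- ns) n).+1 \in ns.
  by rewrite -has_pred1 has_count (ltn_trans _ h).
by rewrite ltnn.
Qed.

Lemma merge_order1 n : merge_order [:: n] = n.
Proof. by rewrite /merge_order big_seq1 /= eqxx. Qed.

Lemma perm_merge_order ns ms : perm_eq ns ms -> merge_order ns = merge_order ms.
Proof.
move=> h; rewrite /merge_order (perm_big _ h) /=.
by move/seq.permP: h => ->.
Qed.

(** The effect of pruning on the orders of the children: those of order 1
disappear and the others lose 1.  Upper bounds on both sides involve the same
counts, shifted by 1. *)
Lemma merge_order_pred ns : 0 \notin ns -> 1 < size ns ->
  (merge_order (map predn (seq.filter (fun n => 1 < n) ns))).+1 = merge_order ns.
Proof.
move=> n0 s1; set ms := map _ _.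
have cE K : count (fun n => K < n) ms = count (fun n => K.+1 < n) ns.
  by rewrite count_map count_filter; apply: eq_count => n /=; lia.
have m0 : 0 < merge_order ms.
  apply: merge_order_gt0; apply/mapP => -[n]; rewrite mem_filter.
  by case: n => [|[|n]].
have m1 : 1 < merge_order ns.
  rewrite ltnNge merge_order_leS.
  have -> : count (fun n => 0 < n) ns = size ns; last by lia.
  apply/eqP; rewrite -all_count; apply/allP => n nns.
  by rewrite lt0n; apply: contraNneq n0 => <-.
have h K : (merge_order ms <= K.+1) = (merge_order ns <= K.+2).
  by rewrite !merge_order_leS !cE.
apply/eqP; rewrite eqn_leq; apply/andP; split.
  case e : (merge_order ns) m1 => [|[|K]] // _.
  by rewrite ltnS h e.
by case e : (merge_order ms) m0 => [|K] // _; rewrite -h e.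
Qed.

Lemma order_gt1 t : branching t -> t != phi -> 1 < order t.
Proof.
case: t => ts /= /andP[s1 _] t0; rewrite ltnNge merge_order_leS.
have -> : count (fun n => 0 < n) (map order ts) = size ts.
  rewrite -(size_map order); apply/eqP; rewrite -all_count.
  by apply/allP => _ /mapP[s _ ->]; exact: order_gt0.
by case: ts s1 t0 => [|s [|s' ts]].
Qed.

(** One pruning step on a tree hanging below a parent, where the top vertex is
also subject to series reduction. *)
Definition prune_branch (t : tree) : tree := suppress (cut_leaves t).

Lemma prune_branchE ts :
  prune_branch (Node ts) =
  let us := map prune_branch (seq.filter (predC1 phi) ts) in
  if us is [:: u] then u else Node us.
Proof.
rewrite /prune_branch /= -/suppress.
suff -> : [seq suppress i | i <- pmap
    (fun s => if s is Node [::] then None else Some (cut_leaves s)) ts] =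
  [seq suppress (cut_leaves t) | t <- ts & t != phi] by [].
elim: ts => // -[[|u us]] ts IH; first exact: IH.
have -> : [seq t <- Node (u :: us) :: ts | t != phi] =
  Node (u :: us) :: [seq t <- ts | t != phi].
  by rewrite [LHS]/=; case: eqP.
by rewrite [RHS]map_cons -IH.
Qed.

(** When a single child survives, the vertex is suppressed; the order is still
the merge of the surviving orders because merge_order [:: n] = n. *)
Lemma order_prune_branch t : branching t -> t != phi ->
  branching (prune_branch t) /\ (order (prune_branch t)).+1 = order t.
Proof.
elim/tree_nested_ind: t => ts IH /= /andP[s1 bts] t0.
rewrite prune_branchE /=; set us := map _ _.
have ub : all branching us.
  apply/allP => x /mapP[u]; rewrite mem_filter => /andP[/= u0 uts] ->.
  have /(nthP phi)[k lk uk] := uts; move: (IH k lk); rewrite uk => IHu.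
  by apply: (IHu _ u0).1; exact: (allP bts).
have -> : merge_order (map order ts) = (merge_order (map order us)).+1.
  rewrite -merge_order_pred ?size_map; last 2 first.
  - apply/mapP => -[u _ h]; by have := order_gt0 u; rewrite -h.
  - by move: s1 t0; case: (ts) => [|s [|s' ts']].
  congr (merge_order _).+1; rewrite /us filter_map -!map_comp.
  have -> : seq.filter (preim order (fun n => 1 < n)) ts = seq.filter (predC1 phi) ts.
    apply: eq_in_filter => u /(allP bts) ub' /=.
    apply/idP/idP => [|/(order_gt1 ub')//]; apply: contraTneq => ->.
    by rewrite /= /merge_order big_nil.
  apply/eq_in_map => u; rewrite mem_filter => /andP[/= u0 uts].
  have /(nthP phi)[k lk uk] := uts.
  move: (IH k lk); rewrite uk => IHu /=.
  by rewrite -(IHu (allP bts _ uts) u0).2.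
case: us ub => [|u [|u' us]] //=; first by rewrite andbT merge_order1.
Qed.

Lemma ord_phi : ord phi = 0.
Proof. by rewrite /ord; case: ex_minnP => k _ /(_ 0 isT); case: k. Qed.

Lemma ordS t : t != phi -> ord t = (ord (prune t)).+1.
Proof.
move=> t0; rewrite /ord; case: ex_minnP => k hk mk.
case: ex_minnP => l hl ml; apply/eqP; rewrite eqn_leq; apply/andP; split.
  by apply: mk; rewrite iterSr.
case: k hk {mk} => [/=|k]; first by rewrite (negbTE t0).
by rewrite iterSr => /ml.
Qed.

(** Each pruning lowers the recursive order by one and preserves branching, and
the order is 1 exactly when the next pruning leaves the root alone. *)
Lemma ord_planted t : branching t -> ord (Node [:: t]) = order t.
Proof.
have [n] := ubnP (order t); elim: n t => // n IH t ln bt.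
rewrite ordS; last by apply/eqP.
have [->|t0] := eqVneq t phi.
  by rewrite -[prune _]/phi ord_phi /= /merge_order big_nil.
have [bp op] := order_prune_branch bt t0; rewrite -op in ln *.
have -> : prune (Node [:: t]) = Node [:: prune_branch t].
  by case: t t0 {bt bp op ln} => -[|u us].
by rewrite IH.
Qed.

Lemma branching_children t k : branching t -> branching (nth phi (children t) k).
Proof.
case: t => ts /= /andP[_ h]; case: (ltnP k (size ts)) => lk.
  by apply: (allP h); rewrite mem_nth.
by rewrite nth_default.
Qed.

Lemma branching_subtree t u : branching t -> branching (subtree t u).
Proof. by move=> bt; elim: u => //= k u; apply: branching_children. Qed.

Lemma branchingE t : branching t = all (fun v => offspring t v != 1) (vertices t).
Proof.
elim/tree_nested_ind: t => ts IH; rewrite verticesE /=; congr (_ && _).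
apply/allP/allP => h.
  move=> v /flatten_mapP[k]; rewrite mem_iota /= => lk /mapP[w wk ->].
  rewrite offspring_rcons /=.
  have := h _ (mem_nth phi lk); rewrite IH // => /allP; exact.
move=> s /(nthP phi)[k lk <-]; rewrite IH //; apply/allP => v vk.
rewrite -(offspring_rcons (Node ts)); apply: h; apply/flatten_mapP; exists k.
  by rewrite mem_iota.
exact: map_f.
Qed.

Lemma reduced_planted t : reduced (Node [:: t]) = branching t.
Proof.
rewrite branchingE /reduced verticesE /= cats0 all_map; apply: eq_all => v /=.
by rewrite offspring_rcons /is_root -size_eq0 size_rcons.
Qed.

Lemma vord_planted t v : branching t ->
  vord (Node [:: t]) v = order (subtree (Node [:: t]) v).
Proof.
move=> bt; rewrite /vord /is_root; case: (lastP v) => [|u k].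
  by rewrite eqxx ord_planted //= merge_order1.
rewrite -size_eq0 size_rcons /= subtree_rcons /=.
apply: ord_planted; apply: branching_subtree.
by case: k => [|[|k]].
Qed.

Lemma order_child_le t k : k < size (children t) ->
  order (nth phi (children t) k) <= order t.
Proof. by case: t => ts /= lk; apply/merge_order_ge/map_f/mem_nth. Qed.

Lemma order_child_inj t k l : k < size (children t) -> l < size (children t) ->
  order (nth phi (children t) k) = order t ->
  order (nth phi (children t) l) = order t -> k = l.
Proof.
case: t => ts /= lk ll hk hl; have := merge_order_uniq (map order ts).
set m := merge_order _ in hk hl *.
rewrite -[map _ _](mkseq_nth 0) /mkseq count_map size_map -size_filter => h.
have ik : k \in seq.filter (preim (nth 0 (map order ts)) (pred1 m)) (iota 0 (size ts)).
  by rewrite mem_filter mem_iota lk andbT /= (nth_map phi) // hk eqxx.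
have il : l \in seq.filter (preim (nth 0 (map order ts)) (pred1 m)) (iota 0 (size ts)).
  by rewrite mem_filter mem_iota ll andbT /= (nth_map phi) // hl eqxx.
by case: (seq.filter _ _) h ik il => [|x []] //= _; rewrite !inE => /eqP -> /eqP ->.
Qed.

(** * Vertex counts as additive functionals *)

(** The common form of the three vertex counts. *)
Definition tally (h : tree -> nat) (t : tree) : nat :=
  \sum_(u <- vertices t) h (subtree t u).

Lemma tallyE h ts : tally h (Node ts) = h (Node ts) + \sum_(t <- ts) tally h t.
Proof.
rewrite /tally big_vertices /=; congr addn.
rewrite (big_nth phi) /index_iota subn0; apply: eq_bigr => k _.
by apply: eq_bigr => u _; rewrite subtree_rcons.
Qed.

Definition child_orders (t : tree) : seq nat := map order (children t).

(** The contribution of one vertex to N_j, n_(i,j) and the regular n_(i,j).  A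
vertex of order j is the terminal one of its branch iff it has no child of order
j. *)
Definition is_branch_end (j : nat) (t : tree) : nat :=
  (order t == j) && (j \notin child_orders t).

Definition children_of_order (i j : nat) (t : tree) : nat :=
  (order t == j) * count_mem i (child_orders t).

Definition side_children_of_order (i j : nat) (t : tree) : nat :=
  ((order t == j) && (j \in child_orders t)) * count_mem i (child_orders t).

(** * Invariance under isomorphism *)

Lemma iso_perm_map (T : eqType) (f : tree -> T) ss ts n (s : {perm 'I_n}) :
  size ss = n -> size ts = n ->
  (forall i : 'I_n, f (nth phi ss i) = f (nth phi ts (s i))) ->
  perm_eq (map f ss) (map f ts).
Proof.
move=> zs zt h.
have mE us : size us = n -> map f us = [seq f (nth phi us (nat_of_ord i)) | i <- enum 'I_n].
  move=> zu; rewrite -[in LHS](mkseq_nth phi us) /mkseq -map_comp zu.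
  by rewrite -val_enum_ord -map_comp.
rewrite (mE _ zs) (mE _ zt).
rewrite (eq_map (g := (fun i : 'I_n => f (nth phi ts i)) \o s)); last by move=> i; exact: h.
rewrite map_comp; apply: perm_map; apply: uniq_perm.
- by rewrite map_inj_uniq ?enum_uniq //; exact: perm_inj.
- exact: enum_uniq.
move=> i; rewrite mem_enum; apply/mapP; exists (s^-1%g i); rewrite ?mem_enum //.
by rewrite permKV.
Qed.

Lemma iso_order x y : iso x y -> order x = order y.
Proof.
elim/tree_nested_ind: x y => ss IH [ts] /iso_inv[n [s /= [zs zt h]]].
apply: perm_merge_order; apply: (iso_perm_map zs zt) => i.
by apply: IH (h i); rewrite zs.
Qed.

Lemma iso_child_orders x y : iso x y -> perm_eq (child_orders x) (child_orders y).
Proof.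
move=> /iso_inv[n [s [zs zt h]]]; apply: (iso_perm_map zs zt) => i.
exact: iso_order.
Qed.

Definition iso_invariant (h : tree -> nat) := forall x y, iso x y -> h x = h y.

Lemma iso_tally h : iso_invariant h -> iso_invariant (tally h).
Proof.
move=> hh x y; elim/tree_nested_ind: x y => ss IH [ts] i.
rewrite !tallyE (hh _ _ i); congr addn.
case/iso_inv: i => n [s [/= zs zt hs]].
rewrite -(big_map (tally h) xpredT id) -[RHS](big_map (tally h) xpredT id).
apply: perm_big; apply: (iso_perm_map zs zt) => i.
by apply: IH (hs i); rewrite zs.
Qed.

(** * Branches of a planted tree *)

Lemma card_vertices t (P : pred (seq nat)) :
  #|[set v : vertex t | P (val v)]| = \sum_(v <- vertices t) P v.
Proof.
rewrite cardsE -sum1_card big_mkcond /=.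
have e : map val (index_enum (vertex t)) = vertices t.
  by rewrite [index_enum _]unlock unlock val_seq_sub_enum ?uniq_vertices.
rewrite -[in RHS]e big_map; apply: eq_bigr => v _.
by rewrite unfold_in /=; case: (P _).
Qed.

Lemma parent_vertices t v (P : pred (seq nat)) : v \in vertices t ->
  [exists u : vertex t, parent (val u) v && P (val u)] =
  (if v is _ :: u then P u else false).
Proof.
case: v => [|k u] hv; first by apply/existsP => -[].
apply/existsP/idP => [[w /= /andP[/eqP <-]] //|pu].
move: hv; rewrite cons_vertices => /andP[hu _].
by exists (SeqSub hu); rewrite /= eqxx.
Qed.

Lemma count_child_orders i t :
  count_mem i (child_orders t) =
  \sum_(0 <= k < size (children t)) (order (nth phi (children t) k) == i).
Proof.
rewrite count_map -sum1_count big_mkcond (big_nth phi).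
by apply: eq_bigr => k _ /=; case: eqP.
Qed.

Section Planted.
Variable t : tree.
Hypothesis bt : branching t.
Let T := Node [:: t].

Lemma order_subtree_le p v : p ++ v \in vertices T ->
  order (subtree T (p ++ v)) <= order (subtree T v).
Proof.
elim: p => // k p IH; rewrite cat_cons cons_vertices => /andP[/IH h lk].
by apply: leq_trans h; exact: order_child_le.
Qed.

Lemma cat_vertices p v : p ++ v \in vertices T -> v \in vertices T.
Proof. by elim: p => // k p IH; rewrite cat_cons cons_vertices => /andP[/IH]. Qed.

(** A vertex has at most one child of its own order, so a branch is a descending
path; from its lowest vertex one can only climb. *)
Lemma branch_end_ancestors (u w : vertex T) :
  order (subtree T (val u)) \notin child_orders (subtree T (val u)) ->
  connect (@same_branch_edge T) u w -> suffix (val w) (val u).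
Proof.
move=> ue; case/connectP => p pp ->{w}.
suff : suffix (val (last u p)) (val u) &&
  (order (subtree T (val (last u p))) == order (subtree T (val u))) by case/andP.
elim/last_ind: p pp => [|p y IH]; first by rewrite suffix_refl eqxx.
rewrite rcons_path last_rcons => /andP[/IH{IH}].
move: (last u p) => x /andP[/suffixP[s us] /eqP xo].
rewrite /same_branch_edge !vord_planted // => /andP[/eqP xy].
rewrite xo in xy; rewrite -xy eqxx andbT.
case: x y us xo xy => x xT [y yT] /= us xo xy.
rewrite -[ssval u]/(val u) in us xo xy *.
case/orP; rewrite /parent.
  case: y yT xy => // k v yT xy /eqP xv; subst v.
  have lk : k < offspring T x by move: yT; rewrite cons_vertices => /andP[].
  (* l :: x is the child of x on the way down to u *)
  case/lastP: s us => [|s l] us.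
    case/negP: ue; rewrite us /= [X in X \in _]xo xy; apply/mapP.
    by exists (nth phi (children (subtree T x)) k); rewrite ?mem_nth.
  rewrite cat_rcons in us.
  have uT : s ++ l :: x \in vertices T by rewrite -us; exact: (valP u).
  have lT := cat_vertices uT.
  have ll : l < offspring T x by move: lT; rewrite cons_vertices => /andP[].
  have h1 := order_subtree_le uT; rewrite -us -xo in h1.
  have h2 := @order_subtree_le [:: l] x lT.
  have -> : k = l.
    apply: (@order_child_inj (subtree T x)) => //.
      by rewrite xo xy.
    by apply/eqP; rewrite eqn_leq h2 h1.
  by rewrite us; apply/suffixP; exists s.
case: x xT us xo => // k v xT us xo /eqP ->; rewrite us.
by apply/suffixP; exists (rcons s k); rewrite cat_rcons.
Qed.

Lemma same_branch_child (u : vertex T) :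
  order (subtree T (val u)) \in child_orders (subtree T (val u)) ->
  exists2 w, same_branch_edge u w & size (val w) = (size (val u)).+1.
Proof.
move=> /mapP[s /(nthP phi)[k lk <-]] ek.
have wT : k :: val u \in vertices T by rewrite cons_vertices lk (valP u).
exists (SeqSub wT) => //=.
by rewrite /same_branch_edge !vord_planted //= eqxx /= ek eqxx.
Qed.

Lemma terminal_planted (u : vertex T) : terminal u =
  (order (subtree T (val u)) \notin child_orders (subtree T (val u))).
Proof.
apply/forallP/idP => [h|ue w].
  apply/negP => /same_branch_child[w uw sw].
  by have := h w; rewrite (connect1 uw) sw ltnn.
by apply/implyP => /(branch_end_ancestors ue); exact: size_suffix.
Qed.

Lemma same_branch_sym : symmetric (@same_branch_edge T).
Proof. by move=> u v; rewrite /same_branch_edge eq_sym orbC. Qed.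

Lemma connect_vord (u w : vertex T) :
  connect (@same_branch_edge T) u w -> vord T (val u) = vord T (val w).
Proof.
case/connectP => p pp ->{w}; elim: p u pp => //= w p IH u /andP[/andP[/eqP -> _]].
exact: IH.
Qed.

(** Two terminal vertices of one branch are ancestors of each other, hence
equal; a deepest vertex of a branch is terminal. *)
Lemma num_branches_planted j :
  num_branches T j = #|[set u : vertex T | (vord T (val u) == j) && terminal u]|.
Proof.
set e := @same_branch_edge T.
have sc : connect_sym e by apply: sym_connect_sym; exact: same_branch_sym.
rewrite /num_branches /n_comp_mem -/e.
have inj : {in [set u : vertex T | (vord T (val u) == j) && terminal u] &,
    injective (fingraph.root e)}.
  move=> u w; rewrite !inE !terminal_planted => /andP[_ ue] /andP[_ we] /eqP.
  rewrite (root_connect sc) => uw.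
  have /suffixP[p hp] := branch_end_ancestors ue uw.
  rewrite sc in uw; have /size_suffix := branch_end_ancestors we uw.
  rewrite hp size_cat => h; apply: val_inj; rewrite hp.
  by case: p h {hp} => //= k p; lia.
rewrite -(card_in_imset inj); apply: eq_card => r; rewrite !inE.
apply/andP/imsetP => [[rr /eqP rj]|[u]].
  (* the deepest vertex of the component is its terminal vertex *)
  case: (@arg_maxnP _ r (connect e r) (fun w => size (val w))); first exact: connect0.
  move=> u ru um; exists u.
    rewrite inE -(connect_vord ru) rj eqxx /= terminal_planted.
    apply/negP => /same_branch_child[w uw sw].
    move: (um w (connect_trans ru (connect1 uw))).
    by apply/negP; rewrite -ltnNge sw.
  move/(fingraph.rootP sc): ru => <-; apply/esym/eqP; exact: rr.
rewrite inE => /andP[/eqP uj _] ->; split; first exact: roots_root.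
by rewrite -uj; apply/eqP/esym/connect_vord; exact: connect_root.
Qed.

End Planted.

Lemma sum_children_of_order i t (P : pred (seq nat)) :
  \sum_(v <- vertices t) nat_of_bool
    (if v is _ :: u then (order (subtree t v) == i) && P u else false) =
  \sum_(u <- vertices t) P u * count_mem i (child_orders (subtree t u)).
Proof.
rewrite sum_vertices_by_parent add0n; apply: eq_bigr => u _.
rewrite count_child_orders big_distrr /=; apply: eq_bigr => k _.
by rewrite mulnC mulnb.
Qed.

(** The root of a planted tree has the order of its child, so it contributes to
none of the counts. *)
Lemma tally_planted h t : h (Node [:: t]) = 0 -> tally h (Node [:: t]) = tally h t.
Proof. by rewrite tallyE big_seq1 => ->. Qed.

Lemma num_branches_tally t j : branching t ->
  num_branches (Node [:: t]) j = tally (is_branch_end j) t.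
Proof.
move=> bt; rewrite num_branches_planted // -tally_planted; last first.
  rewrite /is_branch_end /child_orders /= merge_order1 inE eq_sym.
  by case: eqP.
rewrite /tally -card_vertices; apply: eq_card => u; rewrite !inE.
rewrite terminal_planted // vord_planted // /is_branch_end.
by case: eqP => //= ->.
Qed.

Lemma num_side_tally t i j : branching t -> i < j ->
  num_side (Node [:: t]) i j = tally (children_of_order i j) t.
Proof.
move=> bt ij; rewrite -tally_planted; last first.
  rewrite /children_of_order /child_orders /= merge_order1 addn0.
  by case: eqP => //= ->; case: eqP => // h; move: ij; rewrite h ltnn.
rewrite /tally /children_of_order.
rewrite -(sum_children_of_order i _ (fun u => order (subtree _ u) == j)).
rewrite -card_vertices.
apply: eq_card => v; rewrite !inE.
rewrite (parent_vertices (fun u => vord _ u == j)) ?vord_planted //.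
  by case: (val v) => [|k u]; rewrite ?andbF // vord_planted.
exact: valP.
Qed.

Lemma num_side_regular_tally t i j : branching t -> i < j ->
  num_side_regular (Node [:: t]) i j = tally (side_children_of_order i j) t.
Proof.
move=> bt ij; rewrite -tally_planted; last first.
  rewrite /side_children_of_order /child_orders /= merge_order1 addn0.
  by case: eqP => //= ->; case: eqP => [h|]; rewrite ?muln0 //; move: ij; rewrite h ltnn.
rewrite /tally /side_children_of_order.
rewrite -(sum_children_of_order i _ (fun u => (order (subtree _ u) == j) &&
  (j \in child_orders (subtree _ u)))).
rewrite -card_vertices.
apply: eq_card => v; rewrite !inE.
pose P u := (order (subtree (Node [:: t]) u) == j) &&
  (j \in child_orders (subtree (Node [:: t]) u)).
have -> : [exists u : vertex (Node [:: t]), [&& parent (val u) (val v),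
    vord (Node [:: t]) (val u) == j & ~~ terminal u]] =
  [exists u : vertex (Node [:: t]), parent (val u) (val v) && P (val u)].
  apply: eq_existsb => w; congr andb.
  rewrite terminal_planted // vord_planted // negbK /P.
  by case: eqP => //= ->.
rewrite parent_vertices ?vord_planted //; last exact: valP.
by case: (val v) => [|k u]; rewrite ?andbF.
Qed.

Lemma iso_is_branch_end j : iso_invariant (is_branch_end j).
Proof.
move=> x y i; rewrite /is_branch_end (iso_order i).
by rewrite (perm_mem (iso_child_orders i)).
Qed.

Lemma iso_children_of_order i j : iso_invariant (children_of_order i j).
Proof.
move=> x y e; rewrite /children_of_order (iso_order e).
by move/seq.permP: (iso_child_orders e) => ->.
Qed.

Lemma iso_side_children_of_order i j : iso_invariant (side_children_of_order i j).
Proof.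
move=> x y e; rewrite /side_children_of_order (iso_order e).
rewrite (perm_mem (iso_child_orders e)).
by move/seq.permP: (iso_child_orders e) => ->.
Qed.

Local Open Scope classical_set_scope.
Local Open Scope ring_scope.

(** * Sums of nonnegative families *)

Section HasSum.
Variable R : realType.

(** Nonnegative real families with a finite sum; keeping the sum real makes all
later identities ordinary field computations. *)
Definition has_sum (T : choiceType) (f : T -> R) (v : R) : Prop :=
  (forall x, 0 <= f x) /\ \esum_(x in [set: T]) (f x)%:E = v%:E.

Section Basics.
Variable T : choiceType.
Implicit Types f g : T -> R.

Lemma eq_has_sum f g v : f =1 g -> has_sum f v -> has_sum g v.
Proof. by move=> /funext ->. Qed.

Lemma has_sum_ge0 f v : has_sum f v -> 0 <= v.
Proof.
case=> f0 e; rewrite -lee_fin -e; apply: esum_ge0 => x _; rewrite lee_fin.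
exact: f0.
Qed.

Lemma has_sum_unique f v w : has_sum f v -> has_sum f w -> v = w.
Proof. by move=> [_ e] [_]; rewrite e => -[]. Qed.

Lemma has_sum0 : has_sum (fun _ : T => 0) 0.
Proof. by split => //; apply: esum1. Qed.

Lemma has_sumD f g v w : has_sum f v -> has_sum g w ->
  has_sum (fun x => f x + g x) (v + w).
Proof.
move=> [f0 ef] [g0 eg]; split=> [x|]; first exact: addr_ge0.
under eq_esum do rewrite EFinD.
by rewrite esumD ?ef ?eg // => x _; rewrite lee_fin.
Qed.

Lemma le_has_sum f g v : (forall x, 0 <= f x) -> (forall x, f x <= g x) ->
  has_sum g v -> exists2 w, has_sum f w & w <= v.
Proof.
move=> f0 fg [g0 eg].
have le : (\esum_(x in [set: T]) (f x)%:E <= v%:E)%E.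
  by rewrite -eg; apply: le_esum => x _; rewrite lee_fin.
have ge : (0 <= \esum_(x in [set: T]) (f x)%:E)%E.
  by apply: esum_ge0 => x _; rewrite lee_fin.
case e : (esum _ _) le ge => [w||] // le ge.
by exists w; [split | rewrite -lee_fin].
Qed.

Lemma has_sumB f g v w : (forall x, f x <= g x) ->
  has_sum f v -> has_sum g w -> has_sum (fun x => g x - f x) (w - v).
Proof.
move=> fg fv gw; have [f0 _] := fv.
have [] := @le_has_sum (fun x => g x - f x) g w _ _ gw.
- by move=> x; rewrite subr_ge0.
- by move=> x; rewrite gerBl.
move=> u hu _; rewrite (_ : w - v = u) //.
have : has_sum g (v + u).
  by apply: eq_has_sum (has_sumD fv hu) => x; rewrite addrC subrK.
by move/(has_sum_unique gw) ->; rewrite addrC addKr.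
Qed.

(** Finiteness from a uniform bound on truncations: a finite set of indices has
bounded level h. *)
Lemma has_sum_trunc (h : T -> nat) f (V : R) : (forall x, 0 <= f x) ->
  (forall n, exists2 v, has_sum (fun x => if (h x <= n)%N then f x else 0) v & v <= V) ->
  exists2 v, has_sum f v & v <= V.
Proof.
move=> f0 hn.
have le : (\esum_(x in [set: T]) (f x)%:E <= V%:E)%E.
  apply: ge_ereal_sup => _ [X [finX _] <-].
  have [n hX] : exists n, forall x, X x -> (h x <= n)%N.
    exists (\max_(x <- finmap.enum_fset (fset_set X)) h x)%N => x Xx.
    have xX := in_fset_set finX x; rewrite (mem_set Xx) in xX.
    exact: (@leq_bigmax_seq _ _ xpredT h x xX isT).
  have [v [g0 ev] vV] := hn n.
  apply: (@le_trans _ _ v%:E); last by rewrite lee_fin.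
  rewrite -ev; apply: esum_ge; exists X; first by split.
  rewrite le_eqVlt; apply/orP; left; apply/eqP.
  by apply: eq_fsbigr => x; move=> /set_mem/hX ->.
have ge : (0 <= \esum_(x in [set: T]) (f x)%:E)%E.
  by apply: esum_ge0 => x _; rewrite lee_fin.
case e : (esum _ _) le ge => [w||] // le ge.
by exists w; [split | rewrite -lee_fin].
Qed.

End Basics.

Lemma has_sum1 (T : choiceType) (x0 : T) (f : T -> R) : 0 <= f x0 ->
  (forall x, x != x0 -> f x = 0) -> has_sum f (f x0).
Proof.
move=> f0 fx; split=> [x|]; first by case: (eqVneq x x0) => [->|/fx ->].
rewrite -(@esum_set1 _ _ x0 (fun x => (f x)%:E)) ?lee_fin // [RHS]esum_mkcond.
apply: eq_esum => x _; case: ifPn => //; rewrite notin_setE /= => /eqP /fx -> //.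
Qed.

Lemma has_sum_inj (T S : choiceType) (e : T -> S) (f : S -> R) v :
  injective e -> (forall y, 0 <= f y) -> (forall y, (forall x, y <> e x) -> f y = 0) ->
  has_sum (f \o e) v <-> has_sum f v.
Proof.
move=> ie f0 fe.
have -> : has_sum f v <-> \esum_(y in [set: S]) (f y)%:E = v%:E by split=> [[]|].
have -> : has_sum (f \o e) v <-> \esum_(x in [set: T]) (f (e x))%:E = v%:E.
  by split=> [[]//|h]; split => // x /=.
suff -> : \esum_(y in [set: S]) (f y)%:E = \esum_(x in [set: T]) (f (e x))%:E by [].
rewrite -(esum_image [set: T] e (fun y => (f y)%:E)); last by move=> x y _ _ /ie.
rewrite [RHS]esum_mkcond; apply: eq_esum => y _; case: ifPn => //.
rewrite notin_setE => h; rewrite fe // => x yx.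
by apply: h; exists x.
Qed.

Lemma has_sumZ (T : choiceType) (f : T -> R) k v : 0 <= k -> has_sum f v ->
  has_sum (fun x => k * f x) (k * v).
Proof.
have le c g w : 0 <= c -> has_sum g w ->
    (\esum_(x in [set: T]) (c * g x)%:E <= (c * w)%:E)%E.
  move=> c0 [g0 ew]; apply: ge_ereal_sup => _ [X [finX _] <-].
  rewrite fsbig_finite //= sumEFin -mulr_sumr lee_fin ler_wpM2l //.
  rewrite -lee_fin -sumEFin -fsbig_finite //= -ew.
  by apply: ereal_sup_ubound; exists X.
move=> k0 fv; have [f0 ef] := fv.
have kf0 x : 0 <= k * f x by exact: mulr_ge0.
have [<-|kn0] := eqVneq 0 k.
  by rewrite mul0r; apply: eq_has_sum (has_sum0 T) => x; rewrite mul0r.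
have kp : 0 < k by rewrite lt_neqAle kn0.
split=> //; apply/eqP; rewrite eq_le le //=.
have ge : (0 <= \esum_(x in [set: T]) (k * f x)%:E)%E.
  by apply: esum_ge0 => x _; rewrite lee_fin.
case e : (esum _ _) (le _ _ _ k0 fv) ge => [w||] // _ ge.
have : (\esum_(x in [set: T]) (k^-1 * (k * f x))%:E <= (k^-1 * w)%:E)%E.
  by apply: le; [rewrite invr_ge0 | split].
under eq_esum do rewrite mulKf 1?eq_sym //.
by rewrite ef !lee_fin mulrC ler_pdivlMr // mulrC.
Qed.

Lemma has_sumM (T S : choiceType) (f : T -> R) (g : S -> R) v w :
  has_sum f v -> has_sum g w -> has_sum (fun p : T * S => f p.1 * g p.2) (v * w).
Proof.
move=> fv gw; have [f0 ef] := fv; have [g0 eg] := gw.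
split=> [p|]; first exact: mulr_ge0.
rewrite (_ : [set: T * S] = [set: T] `*`` (fun=> [set: S])); last first.
  by apply/seteqP; split.
rewrite -(esum_esum (a := fun x y => (f x * g y)%:E)); last first.
  by move=> x y _ _; rewrite lee_fin mulr_ge0.
under eq_esum => x _ do rewrite (has_sumZ (f0 x) gw).2 mulrC.
by rewrite (has_sumZ (has_sum_ge0 gw) fv).2 mulrC.
Qed.

Lemma has_sum_fibers (T : choiceType) (h : T -> nat) (f : T -> R) (v : nat -> R) V :
  (forall n, has_sum (fun x => if h x == n then f x else 0) (v n)) ->
  series v @ \oo --> V -> has_sum f V.
Proof.
move=> hv vV.
have f0 x : 0 <= f x by have := (hv (h x)).1 x; rewrite eqxx.
split=> //; rewrite (_ : [set: T] = \bigcup_(n in [set: nat]) [set x | h x = n]).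
  rewrite esum_bigcupT; last 2 first.
  - by move=> m n _ _ [x [/= <- <-]].
  - by move=> x; rewrite lee_fin.
  have e n : \esum_(x in [set x | h x = n]) (f x)%:E = (v n)%:E.
    rewrite esum_mkcond -(hv n).2; apply: eq_esum => x _.
    by case: eqP => [hx|hx]; [rewrite mem_set | rewrite memNset].
  under eq_esum do rewrite e.
  rewrite -nneseries_esumT; last by move=> n; rewrite lee_fin (has_sum_ge0 (hv n)).
  apply: cvg_lim => //.
  rewrite (_ : (fun n => _) = EFin \o series v); last first.
    by apply/funext => n /=; rewrite /series /= sumEFin.
  by apply: cvg_EFin => //; apply: nearW.
by apply/seteqP; split=> // x _; exists (h x).
Qed.

End HasSum.

(** * Products over a list with marked entries *)

Section Marks.
Variables (R : realType) (T : choiceType).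
Implicit Types (a b f g w : T -> R) (ts : seq T).

(** The derivative in the direction a of the product of g over the list; mark2 is
the mixed second derivative in the directions a and b. *)
Fixpoint mark1 a g ts : R :=
  if ts is t :: ts' then a t * \prod_(s <- ts') g s + g t * mark1 a g ts' else 0.

Fixpoint mark2 a b g ts : R :=
  if ts is t :: ts' then
    a t * mark1 b g ts' + b t * mark1 a g ts' + g t * mark2 a b g ts'
  else 0.

Lemma mark1M w a g ts :
  mark1 (fun t => a t * w t) (fun t => g t * w t) ts =
  mark1 a g ts * \prod_(s <- ts) w s.
Proof.
elim: ts => /= [|t ts ->]; first by rewrite mul0r.
by rewrite big_cons big_split /=; ring.
Qed.

Lemma mark2M w a b g ts :
  mark2 (fun t => a t * w t) (fun t => b t * w t) (fun t => g t * w t) ts =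
  mark2 a b g ts * \prod_(s <- ts) w s.
Proof.
elim: ts => /= [|t ts ->]; first by rewrite mul0r.
by rewrite !mark1M big_cons; ring.
Qed.

Lemma mark1_0 g ts : mark1 (fun=> 0) g ts = 0.
Proof. by elim: ts => //= t ts ->; rewrite mul0r mulr0 addr0. Qed.

Lemma mark1D a b g ts :
  mark1 (fun t => a t + b t) g ts = mark1 a g ts + mark1 b g ts.
Proof. by elim: ts => /= [|t ts ->]; [rewrite addr0 | ring]. Qed.

(** Leibniz rule: the factor f t joins the factor at t, so that adding up f over
all entries marks every factor in turn. *)
Lemma sum_prod_mark f g ts :
  (\sum_(t <- ts) f t) * \prod_(s <- ts) g s = mark1 (fun t => f t * g t) g ts.
Proof.
elim: ts => [|t ts IH] /=; first by rewrite big_nil mul0r.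
by rewrite !big_cons -IH; ring.
Qed.

(** The entry counted by f is either the one already marked by b or another one,
which then becomes a second mark. *)
Lemma sum_mark1 f b g ts :
  (\sum_(t <- ts) f t) * mark1 b g ts =
  mark1 (fun t => f t * b t) g ts + mark2 (fun t => f t * g t) b g ts.
Proof.
elim: ts => [|t ts IH] /=; first by rewrite mulr0 addr0.
rewrite !big_cons -sum_prod_mark.
transitivity (f t * b t * (\prod_(s <- ts) g s) +
  g t * ((\sum_(t0 <- ts) f t0) * mark1 b g ts) + f t * g t * mark1 b g ts +
  b t * ((\sum_(t0 <- ts) f t0) * \prod_(s <- ts) g s)); first by ring.
by rewrite IH; ring.
Qed.

Lemma prod_ge0 g ts : (forall t, 0 <= g t) -> 0 <= \prod_(s <- ts) g s.
Proof. by move=> g0; apply: prodr_ge0. Qed.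

Lemma mark1_ge0 a g ts : (forall t, 0 <= a t) -> (forall t, 0 <= g t) ->
  0 <= mark1 a g ts.
Proof.
move=> a0 g0; elim: ts => //= t ts IH.
by rewrite addr_ge0 ?mulr_ge0 ?prod_ge0.
Qed.

Lemma mark2_ge0 a b g ts : (forall t, 0 <= a t) -> (forall t, 0 <= b t) ->
  (forall t, 0 <= g t) -> 0 <= mark2 a b g ts.
Proof.
move=> a0 b0 g0; elim: ts => //= t ts IH.
by rewrite !addr_ge0 ?mulr_ge0 ?mark1_ge0.
Qed.

Lemma le_mark1 a b g ts : (forall t, t \in ts -> a t <= b t) ->
  (forall t, 0 <= g t) -> mark1 a g ts <= mark1 b g ts.
Proof.
move=> ab g0; elim: ts ab => //= t ts IH ab.
apply: lerD; first by rewrite ler_wpM2r ?prod_ge0 // ab ?mem_head.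
by rewrite ler_wpM2l // IH // => s sts; rewrite ab // inE sts orbT.
Qed.

Let on_size n (F : seq T -> R) ts := if size ts == n then F ts else 0.

Lemma has_sum_size0 F : 0 <= F [::] -> has_sum (on_size 0 F) (F [::]).
Proof.
move=> F0; apply: (@has_sum1 _ _ [::] (on_size 0 F)) => // -[] //.
Qed.

(** Lists of size n+1 are pairs of a head and a list of size n. *)
Lemma has_sum_sizeS n F v : (forall ts, 0 <= F ts) ->
  has_sum (fun p : T * seq T => on_size n (fun ts => F (p.1 :: ts)) p.2) v ->
  has_sum (on_size n.+1 F) v.
Proof.
move=> F0 h; apply: (iffLR (has_sum_inj (e := fun p : T * seq T => p.1 :: p.2) v _ _ _)).
- by move=> [t ts] [s ss] [-> ->].
- by move=> ts; rewrite /on_size; case: ifP.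
- by case=> [|t ts] // h'; case: (h' (t, ts)).
- by apply: eq_has_sum h => -[t ts].
Qed.

Lemma has_sum_size_mul n a F A v : has_sum a A -> has_sum (on_size n F) v ->
  has_sum (fun p : T * seq T => on_size n (fun ts => a p.1 * F ts) p.2) (A * v).
Proof.
move=> ha hF; apply: eq_has_sum (has_sumM ha hF) => -[t ts] /=.
by rewrite /on_size; case: ifP; rewrite ?mulr0.
Qed.

(** Over the lists of size n, product, first and second derivative sum to those
of the power G ^ n. *)
Lemma has_sum_size_prod g G n : has_sum g G ->
  has_sum (on_size n (fun ts => \prod_(s <- ts) g s)) (G ^+ n).
Proof.
move=> hg; have [g0 _] := hg; elim: n => [|n IH].
  by have := @has_sum_size0 (fun ts => \prod_(s <- ts) g s); rewrite big_nil; apply.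
apply: has_sum_sizeS => [ts|]; first exact: prod_ge0.
rewrite exprS; apply: eq_has_sum (has_sum_size_mul hg IH) => -[t ts].
by rewrite /on_size /= big_cons.
Qed.

Lemma has_sum_size_mark1 a g A G n : has_sum a A -> has_sum g G ->
  has_sum (on_size n (mark1 a g)) (A * (n%:R * G ^+ n.-1)).
Proof.
move=> ha hg; have [a0 _] := ha; have [g0 _] := hg; elim: n => [|n IH].
  by rewrite mul0r mulr0; apply: (@has_sum_size0 (mark1 a g)).
apply: has_sum_sizeS => [ts|]; first exact: mark1_ge0.
have -> : A * (n.+1%:R * G ^+ n.+1.-1) = A * G ^+ n + G * (A * (n%:R * G ^+ n.-1)).
  by case: n {IH} => [|n] /=; rewrite ?exprS -?natr1; ring.
apply: eq_has_sum (has_sumD (has_sum_size_mul ha (has_sum_size_prod n hg))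
  (has_sum_size_mul hg IH)) => -[t ts].
by rewrite /on_size /=; case: ifP; rewrite ?addr0.
Qed.

Lemma has_sum_size_mark2 a b g A B G n : has_sum a A -> has_sum b B ->
  has_sum g G ->
  has_sum (on_size n (mark2 a b g)) (A * B * (n%:R * (n.-1%:R * G ^+ n.-2))).
Proof.
move=> ha hb hg; have [a0 _] := ha; have [b0 _] := hb; have [g0 _] := hg.
elim: n => [|n IH].
  by rewrite mul0r mulr0; apply: (@has_sum_size0 (mark2 a b g)).
apply: has_sum_sizeS => [ts|]; first exact: mark2_ge0.
have -> : A * B * (n.+1%:R * (n.+1.-1%:R * G ^+ n.+1.-2)) =
  A * (B * (n%:R * G ^+ n.-1)) + B * (A * (n%:R * G ^+ n.-1)) +
  G * (A * B * (n%:R * (n.-1%:R * G ^+ n.-2))).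
  by case: n {IH} => [|[|n]] /=; rewrite ?exprS -?natr1; ring.
apply: eq_has_sum (has_sumD (has_sumD
  (has_sum_size_mul ha (has_sum_size_mark1 n hb hg))
  (has_sum_size_mul hb (has_sum_size_mark1 n ha hg)))
  (has_sum_size_mul hg IH)) => -[t ts].
by rewrite /on_size /=; case: ifP; rewrite ?addr0.
Qed.

Lemma has_sum_seq (q : nat -> R) F v V : (forall n, 0 <= q n) ->
  (forall n, has_sum (on_size n F) (v n)) ->
  series (fun n => q n * v n) @ \oo --> V ->
  has_sum (fun ts => q (size ts) * F ts) V.
Proof.
move=> q0 hF; apply: (has_sum_fibers (h := size)) => n.
apply: eq_has_sum (has_sumZ (q0 n) (hF n)) => ts; rewrite /on_size.
by case: eqP => [->|]; rewrite ?mulr0.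
Qed.

End Marks.

(** * Galton-Watson weights of plane trees *)

Section Weights.
Variables (R : realType) (q : nat -> R).
Hypothesis q_ge0 : forall n, 0 <= q n.

Definition weight (t : tree) : R := \prod_(v <- vertices t) q (offspring t v).

Lemma weightE ts : weight (Node ts) = q (size ts) * \prod_(t <- ts) weight t.
Proof.
rewrite /weight big_vertices; congr (_ * _).
rewrite (big_nth phi) /index_iota subn0; apply: eq_bigr => k _.
by apply: eq_bigr => v _; rewrite offspring_rcons.
Qed.

Lemma weight_ge0 t : 0 <= weight t.
Proof. exact: prodr_ge0. Qed.

(** Expectation of f under the law of the subtree hanging at a non-root vertex,
written as a relation so that finiteness is part of the assertion. *)
Definition gw_sum (f : tree -> R) (v : R) := has_sum (fun t => f t * weight t) v.

(** A tree is the list of its subtrees at the root, which are independent given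
their number; the three lemmas below turn the sums over lists into Q, Q' and
Q''. *)
Lemma gw_sum_children (F : seq tree -> R) v :
  has_sum (fun ts => q (size ts) * (F ts * \prod_(t <- ts) weight t)) v ->
  gw_sum (fun t => F (children t)) v.
Proof.
move=> h; apply: (iffLR (has_sum_inj (e := Node) v _ _ _)).
- by move=> x y [].
- by case=> ts /=; have := h.1 ts; rewrite weightE mulrCA.
- by case=> ts /(_ ts).
- by apply: eq_has_sum h => ts /=; rewrite weightE mulrCA.
Qed.

Lemma gw_sum_prod g G V : gw_sum g G -> series (fun n => q n * G ^+ n) @ \oo --> V ->
  gw_sum (fun t => \prod_(s <- children t) g s) V.
Proof.
move=> hg hV; apply: (gw_sum_children (F := fun ts => \prod_(s <- ts) g s)).
under [X in has_sum X]funext do rewrite -big_split.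
by apply: has_sum_seq hV => // n; apply: has_sum_size_prod.
Qed.

Lemma gw_sum_mark1 a g A G V : gw_sum a A -> gw_sum g G ->
  series (fun n => q n * (n%:R * G ^+ n.-1)) @ \oo --> V ->
  gw_sum (fun t => mark1 a g (children t)) (A * V).
Proof.
move=> ha hg hV; apply: (gw_sum_children (F := mark1 a g)).
under [X in has_sum X]funext do rewrite -mark1M.
apply: (@has_sum_seq _ _ _ _ (fun n => A * (n%:R * G ^+ n.-1))) => // [n|].
  exact: has_sum_size_mark1.
rewrite (_ : series _ = (fun n => A * series (fun n => q n * (n%:R * G ^+ n.-1)) n)).
  by apply: cvgM hV; exact: cvg_cst.
by apply/funext => n; rewrite /series /= mulr_sumr; apply: eq_bigr => k _; ring.
Qed.

Lemma gw_sum_mark2 a b g A B G V : gw_sum a A -> gw_sum b B -> gw_sum g G ->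
  series (fun n => q n * (n%:R * (n.-1%:R * G ^+ n.-2))) @ \oo --> V ->
  gw_sum (fun t => mark2 a b g (children t)) (A * B * V).
Proof.
move=> ha hb hg hV; apply: (gw_sum_children (F := mark2 a b g)).
under [X in has_sum X]funext do rewrite -mark2M.
apply: (@has_sum_seq _ _ _ _
  (fun n => A * B * (n%:R * (n.-1%:R * G ^+ n.-2)))) => // [n|].
  exact: has_sum_size_mark2.
rewrite (_ : series _ = (fun n => A * B * series (fun n => q n * (n%:R * (n.-1%:R * G ^+ n.-2))) n)).
  by apply: cvgM hV; exact: cvg_cst.
by apply/funext => n; rewrite /series /= mulr_sumr; apply: eq_bigr => k _; ring.
Qed.

End Weights.

(** * Derivatives of the generating function *)

Section Derivatives.
Variable R : realType.

Lemma cvgn_series_shift (u : nat -> R) : cvgn (series u) ->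
  cvgn (series (fun n => u n.+1)).
Proof.
move=> /cvg_ex[l ul]; apply/cvg_ex; exists (l - u 0%N).
rewrite (_ : series _ = (fun n => series u n.+1 - u 0%N)).
  by apply: cvgB; [rewrite cvg_shiftS | exact: cvg_cst].
by apply/funext => n; rewrite /series /= big_nat_recl // addrC addKr.
Qed.

(** The gap between K and r absorbs the factor n:
n K^(n-1) (r - K) <= r^n - K^n. *)
Lemma cvgn_pseries_diffs (f : nat -> R) K r : (forall n, 0 <= f n) ->
  0 <= K < r -> cvgn (pseries f r) -> cvgn (pseries (pseries_diffs f) K).
Proof.
move=> f0 /andP[K0 Kr] /cvgn_series_shift cf.
have rK : 0 < r - K by rewrite subr_gt0.
have key n : n.+1%:R * K ^+ n * (r - K) <= r ^+ n.+1.
  elim: n => [|n IH]; first by rewrite mul1r expr0; lra.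
  have : K * (n.+1%:R * K ^+ n * (r - K)) <= K * r ^+ n.+1 by rewrite ler_wpM2l.
  have : K ^+ n.+1 * (r - K) <= r ^+ n.+1 * (r - K).
    by rewrite ler_pM2r //; apply: lerXn2r; rewrite ?nnegrE; lra.
  move=> h1 h2; rewrite (exprS r n.+1).
  have -> : n.+2%:R * K ^+ n.+1 * (r - K) =
    K * (n.+1%:R * K ^+ n * (r - K)) + K ^+ n.+1 * (r - K).
    by rewrite -[n.+2%:R]natr1 (exprS K n); ring.
  by lra.
have cf' : cvgn (series (fun n => (r - K)^-1 * (f n.+1 * r ^+ n.+1))).
  exact: is_cvg_seriesZ.
apply: series_le_cvg cf' => n /=.
- by rewrite /pseries_diffs !mulr_ge0 // exprn_ge0.
- rewrite !mulr_ge0 ?invr_ge0 //; first exact: ltW.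
  by apply: exprn_ge0; lra.
rewrite ler_pdivlMl // /pseries_diffs.
have := ler_wpM2l (f0 n.+1) (key n).
by apply: le_trans; rewrite le_eqVlt; apply/orP; left; apply/eqP; ring.
Qed.

Let S (f : nat -> R) (x : R) : R := limn (pseries f x).
Let summable (f : nat -> R) := forall x : R, 0 <= x < 1 -> cvgn (pseries f x).

Lemma summable_diffs (f : nat -> R) : (forall n, 0 <= f n) -> summable f ->
  summable (pseries_diffs f).
Proof.
move=> f0 sf x x01; apply: (@cvgn_pseries_diffs f x ((x + 1) / 2)) => //.
  by lra.
by apply: sf; lra.
Qed.

Lemma diffs_ge0 (f : nat -> R) : (forall n, 0 <= f n) -> forall n, 0 <= pseries_diffs f n.
Proof. by move=> f0 n; rewrite /pseries_diffs mulr_ge0. Qed.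

Lemma is_derive_pseries (f : nat -> R) (x : R) : (forall n, 0 <= f n) -> summable f -> 0 <= x < 1 ->
  is_derive x (1 : R) (S f) (S (pseries_diffs f) x).
Proof.
move=> f0 sf x01; pose K := (x + 1) / 2.
have K01 : 0 <= K < 1 by rewrite /K; lra.
have sf1 := summable_diffs f0 sf.
have sf2 := summable_diffs (diffs_ge0 f0) sf1.
apply: (@pseries_snd_diffs _ f K x); [exact: sf | exact: sf1 | exact: sf2 | ].
by rewrite !ger0_norm /K; lra.
Qed.

(** A derivative at an interior point depends only on the values nearby, so a
closed form on ]0, 1[ suffices. *)
Lemma pseries_deriv_eq (f : nat -> R) (F F' : R -> R) : (forall n, 0 <= f n) -> summable f ->
  (forall x : R, 0 < x < 1 -> S f x = F x) ->
  (forall x : R, 0 < x < 1 -> is_derive x (1 : R) F (F' x)) ->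
  forall x : R, 0 < x < 1 -> S (pseries_diffs f) x = F' x.
Proof.
move=> f0 sf fF dF x x01.
have d1 : is_derive x (1 : R) (S f) (S (pseries_diffs f) x).
  by apply: is_derive_pseries => //; lra.
have d2 : is_derive x (1 : R) (S f) (F' x).
  apply: (@near_eq_is_derive _ _ _ F); [|exact: dF].
  have : \near x, x \in `]0, 1[%R by apply: near_in_itvoo; rewrite in_itv.
  by apply: filterS => y; rewrite in_itv /= => /fF.
by rewrite -(@derive_val _ _ _ _ _ _ _ d1) (@derive_val _ _ _ _ _ _ _ d2).
Qed.

(** The closed form is only known for nonnegative arguments; at 0 it is reached
by continuity from the right. *)
Lemma eq_at_left_end (F G : R -> R) : {for (0 : R), continuous F} ->
  {for (0 : R), continuous G} -> (forall x : R, 0 < x < 1 -> F x = G x) -> F 0 = G 0.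
Proof.
move=> cF cG FG.
have cF' : F x @[x --> 0^'+] --> F 0 by exact: cvg_at_right_filter.
have cG' : G x @[x --> 0^'+] --> G 0 by exact: cvg_at_right_filter.
apply: (cvg_unique _ cF') => //.
apply: cvg_trans cG'; apply: near_eq_cvg; near=> x.
by apply/esym/FG/andP; split; near: x; [exact: nbhs_right_gt|exact: nbhs_right_lt].
Unshelve. all: by end_near. Qed.

Lemma is_derive_continuous (F : R -> R) (x d : R) : is_derive x (1 : R) F d ->
  {for x, continuous F}.
Proof. by case=> dF _; apply/differentiable_continuous/derivable1_diffP. Qed.

End Derivatives.

Section GeneratingFunction.
Variables (R : realType) (q0 : R) (q : nat -> R).
Hypotheses (q0_bounds : 2^-1 <= q0 < 1) (q_ge0 : forall n, 0 <= q n).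
Hypothesis q1 : q 1%N = 0.
Hypothesis gf : generating_function q (fun z => z + q0 * (1 - z) `^ q0^-1).

Lemma is_derive_1B_powR (p x : R) : x < 1 ->
  is_derive x (1 : R) (fun z => (1 - z) `^ p) (- (p * (1 - x) `^ (p - 1))).
Proof.
move=> x1.
have h1 : is_derive x (1 : R) (fun z : R => 1 - z) (- 1).
  by apply: is_derive_eq; rewrite add0r mul1r.
have h2 : is_derive (1 - x) (1 : R) (fun z : R => z `^ p) (p * (1 - x) `^ (p - 1)).
  by apply: is_derive1_powR; rewrite subr_gt0.
by have := is_derive1_comp (g := fun z => 1 - z) h2 h1; rewrite mulrN1.
Qed.

Lemma gf_pseries x : 0 <= x < 1 -> limn (pseries q x) = x + q0 * (1 - x) `^ q0^-1.
Proof. by move=> /andP[x0 x1]; apply/cvg_lim => //; apply: gf; rewrite x0 ltW. Qed.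

Lemma gf_summable x : 0 <= x < 1 -> cvgn (pseries q x).
Proof.
by move=> /andP[x0 x1]; apply/cvg_ex; eexists; apply: gf; rewrite x0 ltW.
Qed.

Lemma gf_deriv1_lim x : 0 <= x < 1 ->
  limn (pseries (pseries_diffs q) x) = 1 - (1 - x) `^ (q0^-1 - 1).
Proof.
move=> /andP[]; rewrite le_eqVlt => /predU1P[<- _|x0 x1].
  rewrite subr0 powR1 subrr; apply/cvg_lim => //.
  rewrite (_ : pseries _ _ = cst 0); first exact: cvg_cst.
  apply/funext => n; rewrite /pseries /series /= big1 // => -[|k] _.
    by rewrite /pseries_diffs q1 mulr0 mul0r.
  by rewrite exprS mul0r mulr0.
apply: (pseries_deriv_eq (F := fun z => z + q0 * (1 - z) `^ q0^-1)
  (F' := fun z => 1 - (1 - z) `^ (q0^-1 - 1)) q_ge0 gf_summable) => //.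
- by move=> y y01; apply: gf_pseries; lra.
- move=> y /andP[_ y1]; have h := is_derive_1B_powR q0^-1 y1.
  apply: is_derive_eq; rewrite /GRing.scale /= ?mulrN mulrA divff ?mul1r //.
  by apply: lt0r_neq0; case/andP: q0_bounds => h2 _; apply: lt_le_trans h2; rewrite invr_gt0.
- by rewrite x0.
Qed.

Lemma gf_deriv2_lim x : 0 <= x < 1 ->
  limn (pseries (pseries_diffs (pseries_diffs q)) x) =
  (q0^-1 - 1) * (1 - x) `^ (q0^-1 - 1 - 1).
Proof.
have s1 := summable_diffs q_ge0 gf_summable.
have s2 := summable_diffs (diffs_ge0 q_ge0) s1.
have pos y : 0 < y < 1 -> limn (pseries (pseries_diffs (pseries_diffs q)) y) =
  (q0^-1 - 1) * (1 - y) `^ (q0^-1 - 1 - 1).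
  apply: (pseries_deriv_eq (F := fun z => 1 - (1 - z) `^ (q0^-1 - 1))
    (F' := fun z => (q0^-1 - 1) * (1 - z) `^ (q0^-1 - 1 - 1))
    (diffs_ge0 q_ge0) s1).
  - by move=> z z01; apply: gf_deriv1_lim; lra.
  - move=> z /andP[_ z1]; have h := is_derive_1B_powR (q0^-1 - 1) z1.
    by apply: is_derive_eq; rewrite add0r opprK mul1r.
move=> /andP[]; rewrite le_eqVlt => /predU1P[<- _|x0 x1]; last by apply: pos; rewrite x0.
have c1 : {for (0 : R), continuous
    (fun y : R => limn (pseries (pseries_diffs (pseries_diffs q)) y))}.
  apply: is_derive_continuous; apply: is_derive_pseries => //.
    exact/diffs_ge0/diffs_ge0.
  by rewrite lexx ltr01.
have c2 : {for (0 : R), continuous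
    (fun y : R => (q0^-1 - 1) * (1 - y) `^ (q0^-1 - 1 - 1))}.
  apply: cvgM; first exact: cvg_cst.
  exact: is_derive_continuous (is_derive_1B_powR (q0^-1 - 1 - 1) ltr01).
exact: (eq_at_left_end c1 c2 pos).
Qed.

Lemma gf_deriv1 x : 0 <= x < 1 ->
  series (fun n => q n * (n%:R * x ^+ n.-1)) @ \oo --> 1 - (1 - x) `^ (q0^-1 - 1).
Proof.
move=> x01; rewrite -gf_deriv1_lim //.
rewrite (_ : (fun n => _) = (fun i => i%:R * q i * x ^+ i.-1)).
  exact: pseries_diffs_equiv (summable_diffs q_ge0 gf_summable x01).
by apply/funext => n; ring.
Qed.

Lemma gf_deriv2 x : 0 <= x < 1 ->
  series (fun n => q n * (n%:R * (n.-1%:R * x ^+ n.-2))) @ \oo -->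
  (q0^-1 - 1) * (1 - x) `^ (q0^-1 - 1 - 1).
Proof.
move=> x01; rewrite -gf_deriv2_lim //.
have s2 := summable_diffs (diffs_ge0 q_ge0) (summable_diffs q_ge0 gf_summable).
rewrite -cvg_shiftS.
rewrite (_ : (fun n => _) = series (fun i => i%:R * pseries_diffs q i * x ^+ i.-1)).
  exact: pseries_diffs_equiv (s2 _ x01).
apply/funext => n; rewrite /series /=.
rewrite big_nat_recl // mul0r mulr0 add0r; apply: eq_bigr => k _ /=.
by rewrite /pseries_diffs; ring.
Qed.

End GeneratingFunction.

(** * Orders and additive functionals in terms of the children *)

Section OrderIndicators.
Variable R : realType.

Definition order_le (K : nat) (t : tree) : R := (order t <= K)%N%:R.
Definition order_eq (K : nat) (t : tree) : R := (order t == K)%:R.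

Lemma order_le_ge0 K t : 0 <= order_le K t. Proof. exact: ler0n. Qed.
Lemma order_eq_ge0 K t : 0 <= order_eq K t. Proof. exact: ler0n. Qed.

Lemma order_leS K t : order_le K.+1 t = order_le K t + order_eq K.+1 t.
Proof.
rewrite /order_le /order_eq -natrD; congr (_%:R).
by rewrite leq_eqVlt ltnS; case: eqP => [->|]; rewrite ?ltnn ?addn0.
Qed.

Lemma prod_order_le K ts : \prod_(t <- ts) order_le K t =
  (count (fun t => K < order t)%N ts == 0%N)%:R.
Proof.
elim: ts => [|t ts IH]; first by rewrite big_nil.
rewrite big_cons IH /= /order_le -natrM; congr (_%:R).
by rewrite leqNgt; case: (K < order t)%N; rewrite ?mul0n ?mul1n.
Qed.

Lemma mark1_order K ts : mark1 (order_eq K.+1) (order_le K) ts =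
  ((count (fun t => K < order t)%N ts == 1%N) &&
   (count (fun t => K.+1 < order t)%N ts == 0%N))%:R.
Proof.
elim: ts => //= t ts ->; rewrite prod_order_le /order_eq /order_le -!natrM -natrD.
congr (_%:R).
have : (count (fun t => K.+1 < order t) ts <= count (fun t => K < order t) ts)%N.
  by apply: sub_count => s /=; lia.
move: (count _ ts) (count (fun t => K < order t)%N ts) => u v uv.
by case: (ltngtP (order t) K.+1) => h; lia.
Qed.

(** The two cases of merge_order_leS exclude each other, so their indicators add
up: a product for no child above K, a first derivative for a single child of
order K+1. *)
Lemma order_le_children K t : order_le K.+1 t =
  \prod_(s <- children t) order_le K s +
  mark1 (order_eq K.+1) (order_le K) (children t).
Proof.
case: t => ts; rewrite prod_order_le mark1_order /order_le /= merge_order_leS.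
have e L : count (fun n => L < n)%N (map order ts) =
  count (fun s => L < order s)%N ts by exact: count_map.
rewrite !e -natrD; congr (_%:R).
by case: (count _ ts =P 0%N) => [->|] //=; rewrite add0n.
Qed.

(** If no child exceeds J, the order is J+1 or at most J; an order J+1 with no
child of order J+1 is the first case. *)
Lemma is_branch_end_marks J t : (is_branch_end J.+1 t)%:R =
  \prod_(s <- children t) order_le J s - order_le J t.
Proof.
apply/eqP; rewrite -subr_eq opprK; apply/eqP.
rewrite prod_order_le /order_le -natrD; congr (_%:R).
rewrite /is_branch_end eqn_leq; case: t => ts; rewrite /child_orders /=.
set ns := map order ts.
have -> : count (fun s => J < order s)%N ts = count (fun n => J < n)%N ns.
  by rewrite count_map.
case: eqP => [c0|/eqP c0].
  have mle : (merge_order ns <= J.+1)%N by rewrite merge_order_leS c0.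
  have -> : J.+1 \notin ns; last by lia.
  apply/negP => h; have : has (fun n => J < n)%N ns by apply/hasP; exists J.+1.
  by rewrite has_count c0.
have /hasP[n nns Jn] : has (fun n => J < n)%N ns by rewrite has_count lt0n.
have nm := merge_order_ge nns.
case: (eqVneq n J.+1) => [e|ne]; last by lia.
by rewrite -e nns; lia.
Qed.

Lemma side_child_marks J t :
  ((order t == J.+1) && (J.+1 \in child_orders t))%:R =
  mark1 (order_eq J.+1) (order_le J) (children t).
Proof.
rewrite mark1_order; congr (nat_of_bool _)%:R.
case: t => ts; rewrite /child_orders /=; set ns := map order ts.
have e L : count (fun s => L < order s)%N ts = count (fun n => L < n)%N ns.
  by rewrite count_map.
rewrite !e; apply/andP/andP => [[/eqP mJ Jns]|h].
  have := merge_order_leS ns J; rewrite mJ leqnn => /esym/orP[|/andP[]//].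
  have : has (fun n => J < n)%N ns by apply/hasP; exists J.+1.
  by rewrite has_count lt0n => /negbTE ->.
have mle : (merge_order ns <= J.+1)%N by rewrite merge_order_leS; case: h => -> ->; rewrite orbT.
have /hasP[n nns Jn] : has (fun n => J < n)%N ns.
  by rewrite has_count; case: h => /eqP ->.
have nm := merge_order_ge nns.
have nJ : n = J.+1 by lia.
by rewrite -nJ nns; split=> //; lia.
Qed.

Lemma count_child_ordersE i t :
  (count_mem i (child_orders t))%:R = \sum_(s <- children t) order_eq i s.
Proof.
rewrite /child_orders count_map -sum1_count natr_sum big_mkcond /=.
by apply: eq_bigr => s _; rewrite /order_eq; case: eqP.
Qed.

(** Leibniz rule for an additive functional on the event that the order is at
most K+1.  The counted child may coincide with the one of order K+1; adding this
case to the counted children of order at most K gives order at most K+1. *)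
Lemma additive_marks (f : tree -> R) K t :
  (\sum_(s <- children t) f s) * order_le K.+1 t =
  mark1 (fun s => f s * order_le K.+1 s) (order_le K) (children t) +
  mark2 (fun s => f s * order_le K s) (order_eq K.+1) (order_le K) (children t).
Proof.
rewrite order_le_children mulrDr sum_prod_mark sum_mark1 addrA -mark1D.
congr (mark1 _ _ _ + _); apply/funext => s.
by rewrite order_leS mulrDr.
Qed.

Fixpoint height (t : tree) : nat :=
  let: Node ts := t in (\max_(n <- map height ts) n).+1.

Lemma height_leS t n : (height t <= n.+1)%N = all (fun s => height s <= n)%N (children t).
Proof.
case: t => ts /=; rewrite ltnS; elim: ts => [|t ts IH] /=; first by rewrite big_nil.
by rewrite big_cons geq_max IH.
Qed.

End OrderIndicators.

(** * The law of the order *)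

Section Expectations.
Variables (R : realType) (q0 : R) (q : nat -> R).
Hypotheses (q0_bounds : 2^-1 <= q0 < 1) (q_ge0 : forall n, 0 <= q n).
Hypothesis q1 : q 1%N = 0.
Hypothesis gf : generating_function q (fun z => z + q0 * (1 - z) `^ q0^-1).

Local Notation c := ((1 - q0)^-1).
Local Notation rho := (c `^ (c - 1)^-1).
Local Notation E := (gw_sum q).
Local Notation le_ K := (@order_le R K).
Local Notation eq_ K := (@order_eq R K).

Lemma q0_gt0 : 0 < q0.
Proof. by case/andP: q0_bounds => h _; apply: lt_le_trans h; rewrite invr_gt0. Qed.

Lemma q0_lt1 : q0 < 1. Proof. by case/andP: q0_bounds. Qed.

Lemma c_ge2 : 2 <= c.
Proof.
case/andP: q0_bounds => h h1; rewrite -[leLHS]invrK lef_pV2 ?posrE ?invr_gt0 ?subr_gt0 //.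
have e : (2 : R)^-1 + 2^-1 = 1 by field.
by rewrite lerBlDr -[leLHS]e lerD2l.
Qed.

Lemma c_gt0 : 0 < c. Proof. by have := c_ge2; lra. Qed.
Lemma c_neq0 : c != 0. Proof. exact: lt0r_neq0 c_gt0. Qed.
Lemma c1_gt0 : 0 < c - 1. Proof. by have := c_ge2; lra. Qed.

Lemma q0E : q0 = (c - 1) / c.
Proof. rewrite mulrBl divff; last exact: c_neq0.
by rewrite mul1r invrK opprB addrC subrK. Qed.

Lemma q0V : q0^-1 = c / (c - 1).
Proof. by rewrite {1}q0E invf_div. Qed.

Lemma q0V1 : q0^-1 - 1 = (c - 1)^-1.
Proof. by rewrite q0V; move: c (lt0r_neq0 c1_gt0) => d hd; field. Qed.

Lemma rho_gt0 : 0 < rho. Proof. exact/powR_gt0/c_gt0. Qed.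
Lemma rho_neq0 : rho != 0. Proof. exact: lt0r_neq0 rho_gt0. Qed.

Lemma rhoE : c `^ (c / (c - 1)) = c * rho.
Proof.
have -> : c / (c - 1) = 1 + (c - 1)^-1.
  by move: c (lt0r_neq0 c1_gt0) => d hd; field.
rewrite powRD ?powRr1 ?(ltW c_gt0) //.
by apply/implyP => _; exact: c_neq0.
Qed.

Lemma tail_powR K x : (c ^- K) `^ x = (c `^ x) ^- K.
Proof.
rewrite -[in LHS]powR_invn ?(ltW c_gt0) // -powRrM mulrC powRrM.
by rewrite powR_invn // powR_ge0.
Qed.

(** P(order <= K), as gw_order shows. *)
Definition sigma K : R := 1 - c ^- K.

Lemma tail_gt0 K : 0 < c ^- K.
Proof. by rewrite invr_gt0 exprn_gt0 // c_gt0. Qed.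

Lemma sigma_bounds K : 0 <= sigma K < 1.
Proof.
have := tail_gt0 K => h; rewrite /sigma subr_ge0 ltrBlDr ltrDl h andbT.
by rewrite invf_le1 ?exprn_gt0 ?c_gt0 // exprn_ege1 //; have := c_ge2; lra.
Qed.

Lemma sigma_tail K : 1 - sigma K = c ^- K.
Proof. by rewrite /sigma; ring. Qed.

Lemma series_gf_sigma K : series (fun n => q n * sigma K ^+ n) @ \oo -->
  sigma K + q0 * c ^- K * rho ^- K.
Proof.
have /andP[s0 s1] := sigma_bounds K.
have := gf (z := sigma K); rewrite s0 (ltW s1) sigma_tail => /(_ isT).
by rewrite tail_powR q0V rhoE exprMn invfM mulrA.
Qed.

Lemma series_deriv1_sigma K :
  series (fun n => q n * (n%:R * sigma K ^+ n.-1)) @ \oo --> 1 - rho ^- K.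
Proof.
have := gf_deriv1 q0_bounds q_ge0 q1 gf (sigma_bounds K).
by rewrite sigma_tail tail_powR q0V1.
Qed.

Lemma series_deriv2_sigma K :
  series (fun n => q n * (n%:R * (n.-1%:R * sigma K ^+ n.-2))) @ \oo -->
  (c - 1)^-1 * (c ^+ K * rho ^- K).
Proof.
have := gf_deriv2 q0_bounds q_ge0 q1 gf (sigma_bounds K).
rewrite sigma_tail powRB; last by apply/implyP => _; exact: lt0r_neq0 (tail_gt0 K).
by rewrite powRr1 ?(ltW (tail_gt0 K)) // invrK tail_powR q0V1 [_ * c ^+ K]mulrC.
Qed.

(** The product pi_(K+1) Q''(sigma_K), the weight of one child of order K+1
together with one marked smaller child.  Its ratio to 1 - Q'(sigma_K) = rho^(-K)
is the constant 1/c: this is the source of the Toeplitz property. *)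
Lemma pi_deriv2 K : q0 * c ^- K * ((c - 1)^-1 * (c ^+ K * rho ^- K)) = c^-1 * rho ^- K.
Proof.
have h := lt0r_neq0 c1_gt0; have := c_neq0 => h'.
have hr : rho ^+ K != 0 by rewrite expf_neq0 // rho_neq0.
have hc : c ^+ K != 0 by rewrite expf_neq0.
rewrite {1}q0E; move: (rho ^+ K) (c ^+ K) hr hc => r s hr hs.
by move: c h h' => d h h'; field; rewrite h h' hr hs.
Qed.

Lemma height_gt0 t : (0 < height t)%N. Proof. by case: t. Qed.

(** The mass v_n of the trees of height at most n satisfies v_(n+1) = Q(v_n), and
Q maps [0, 1] to itself. *)
Lemma gw_total : exists2 M, E (fun=> 1) M & M <= 1.
Proof.
have [] := @has_sum_trunc R _ height (fun t => 1 * weight q t) 1; last 1 first.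
- by move=> M hM M1; exists M.
- by move=> t; rewrite mul1r weight_ge0.
suff h n : exists2 v, E (fun t => (height t <= n)%N%:R) v & v <= 1.
  move=> n; have [v hv v1] := h n; exists v => //.
  by apply: eq_has_sum hv => t; case: ifP; rewrite ?mul0r.
elim: n => [|n [v hv v1]].
  exists 0 => //; apply: eq_has_sum (has_sum0 R _) => t.
  by rewrite leqNgt height_gt0 mul0r.
have v0 := has_sum_ge0 hv.
exists (v + q0 * (1 - v) `^ q0^-1).
  have := gw_sum_prod q_ge0 hv (gf (z := v) _); rewrite v0 v1 => /(_ isT).
  apply: eq_has_sum => t; congr (_ * _); rewrite height_leS.
  elim: (children t) => [|s ts IH]; first by rewrite big_nil.
  by rewrite big_cons IH -natrM mulnb.
have : (1 - v) `^ q0^-1 <= 1 - v.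
  have [->|vn1] := eqVneq v 1.
    by rewrite subrr powR0 // invr_neq0 // lt0r_neq0 // q0_gt0.
  apply: ge1r_powR; first by rewrite subr_gt0 lt_neqAle vn1 v1 /= lerBlDr lerDl.
  by rewrite invf_ge1 ?q0_gt0 // ltW // q0_lt1.
have := q0_gt0; have := q0_lt1; have := powR_ge0 (1 - v) q0^-1; nra.
Qed.

(** With P = pi_(K+1), the two cases of order_le_children give
sigma_K + P = Q(sigma_K) + P Q'(sigma_K), a linear equation for P. *)
Lemma gw_order K : E (le_ K) (sigma K) /\ E (eq_ K.+1) (q0 * c ^- K).
Proof.
have aux k : E (le_ k) (sigma k) ->
    E (eq_ k.+1) (q0 * c ^- k) /\ E (le_ k.+1) (sigma k.+1).
  move=> hk; have [M hM _] := gw_total.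
  have [S hS _] : exists2 S, E (le_ k.+1) S & S <= M.
    apply: le_has_sum hM => t.
      by rewrite mulr_ge0 ?weight_ge0 // order_le_ge0.
    by rewrite ler_wpM2r ?weight_ge0 // lern1 leq_b1.
  have hP : E (eq_ k.+1) (S - sigma k).
    have le t : le_ k t * weight q t <= le_ k.+1 t * weight q t.
      by rewrite ler_wpM2r ?weight_ge0 // order_leS lerDl order_eq_ge0.
    have hB := has_sumB le hk hS.
    by apply: eq_has_sum hB => t; rewrite order_leS; ring.
  have hS' : E (le_ k.+1)
      (sigma k + q0 * c ^- k * rho ^- k + (S - sigma k) * (1 - rho ^- k)).
    have hD := has_sumD (gw_sum_prod q_ge0 hk (@series_gf_sigma k))
      (gw_sum_mark1 q_ge0 hP hk (@series_deriv1_sigma k)).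
    apply: eq_has_sum hD => t.
    by rewrite -mulrDl -order_le_children.
  have eS := has_sum_unique hS hS'.
  have hr : rho ^+ k != 0 by rewrite expf_neq0 // rho_neq0.
  have eP : S - sigma k = q0 * c ^- k.
    apply: (mulIf (invr_neq0 hr)); move: eS.
    by move: (_ ^- k) (c ^- k) => r s; lra.
  rewrite -eP; split=> //; suff -> : sigma k.+1 = S by [].
  have -> : S = 1 - c ^- k + q0 * c ^- k by rewrite -eP /sigma; ring.
  rewrite /sigma exprS; have hc : c ^+ k != 0 by rewrite expf_neq0 // c_neq0.
  move: q0E c_neq0 hc; move: c => d -> hd; move: (d ^+ k) => s hs.
  by field; rewrite hd hs.
have ind k : E (le_ k) (sigma k).
  elim: k => [|k IH]; last exact: (aux k IH).2.
  rewrite /sigma expr0 invr1 subrr; apply: eq_has_sum (has_sum0 R _) => t.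
  by rewrite /order_le leqNgt order_gt0 mul0r.
by split=> //; exact: (aux K (ind K)).1.
Qed.

Lemma gw_order_eq i : (0 < i)%N -> E (eq_ i) (q0 * c ^- i.-1).
Proof. by case: i => // i _; exact: (gw_order i).2. Qed.

(** * Expectations of additive functionals *)

(** The mean of tally h on trees of order at most J + n, per unit of mean of h,
when h lives on trees of order J+1; see gw_additive. *)
Fixpoint order_growth (J n : nat) : R :=
  if n is m.+1 then rho ^+ (J + m) + order_growth J m / c else 0.

Lemma rho_ge1 : 1 <= rho.
Proof.
rewrite -[leLHS](powRr0 c); apply: ler_powR; first by have := c_ge2; lra.
by rewrite invr_ge0 ltW // c1_gt0.
Qed.

(** The equation G_(K+1) = H + Q'(sigma_K) G_(K+1) + pi_(K+1) Q''(sigma_K) G_K,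
with r = rho^K and A = G_K. *)
Lemma affine_fixpoint (H A r d v : R) : r != 0 ->
  v = H + (v * (1 - r^-1) + A * d^-1 * r^-1) <-> v = H * r + A / d.
Proof.
move=> r0; have rV := mulVf r0; split=> [e|->].
  have e' : v / r = H + A / d / r by move: e; rewrite mulrBr mulr1; lra.
  by rewrite -[LHS](divfK r0) e' mulrDl divfK.
transitivity (H * r + A / d + H - H * (r^-1 * r)); first by rewrite rV; ring.
by ring.
Qed.

Section Additive.
Variables (h : tree -> nat) (J : nat) (H : R).
Hypothesis h_order : forall t, h t != 0%N -> order t = J.+1.
Hypothesis gw_h : E (fun t => (h t)%:R) H.

Let f (t : tree) : R := (tally h t)%:R.

Let fE t : f t = (h t)%:R + \sum_(s <- children t) f s.
Proof. by case: t => ts; rewrite /f tallyE natrD natr_sum. Qed.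

Lemma tally_small t : (order t <= J)%N -> tally h t = 0%N.
Proof.
elim/tree_nested_ind: t => ts IH lt; rewrite tallyE.
rewrite (_ : h (Node ts) = 0%N); last first.
  by apply/eqP; apply: contraTT lt => /h_order ->; rewrite -ltnNge.
rewrite big_seq big1 // => s /(nthP phi)[k lk <-]; apply: IH => //.
exact: leq_trans (order_child_le (t := Node ts) lk) lt.
Qed.

Lemma tally_marks K t : (J <= K)%N -> f t * le_ K.+1 t = (h t)%:R +
  (mark1 (fun s => f s * le_ K.+1 s) (le_ K) (children t) +
   mark2 (fun s => f s * le_ K s) (eq_ K.+1) (le_ K) (children t)).
Proof.
move=> JK; rewrite -additive_marks fE mulrDl; congr (_ + _).
have [->|/h_order ht] := eqVneq (h t) 0%N; first by rewrite mul0r.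
by rewrite /order_le ht ltnS JK mulr1.
Qed.

(** The expansion tally_marks makes the mean v on orders at most K+1 a solution of
the affine equation of affine_fixpoint, once v is known to be finite.  For this,
cut the functional to trees of height at most m: since the coefficient
1 - rho^(-K) of v lies in [0, 1[, the solution V of the equation bounds all these
truncations by induction on m. *)
Lemma gw_additive n :
  E (fun t => f t * le_ (J + n)%N t) (H * order_growth J n).
Proof.
have f0 t : 0 <= f t by exact: ler0n.
have w0 t : 0 <= weight q t by exact: weight_ge0.
have H0 : 0 <= H by exact: has_sum_ge0 gw_h.
elim: n => [|n IH].
  rewrite /= mulr0; apply: eq_has_sum (has_sum0 R _) => t.
  rewrite addn0 /order_le /f; case: (leqP (order t) J) => [/tally_small ->|_].
    by rewrite !mul0r.
  by rewrite mulr0 mul0r.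
rewrite addnS; set K := (J + n)%N in IH *; set A := H * _ in IH.
have [hK hP] := gw_order K.
have A0 : 0 <= A by exact: has_sum_ge0 IH.
have r0 : 0 < rho ^- K by rewrite invr_gt0 exprn_gt0 // rho_gt0.
have rK : rho ^+ K != 0 by rewrite expf_neq0 // rho_neq0.
have step (a : tree -> R) v : E a v -> E (fun t => (h t)%:R +
    (mark1 a (le_ K) (children t) +
     mark2 (fun s => f s * le_ K s) (eq_ K.+1) (le_ K) (children t)))
    (H + (v * (1 - rho ^- K) + A * c^-1 * rho ^- K)).
  move=> ha.
  have h1 := gw_sum_mark1 q_ge0 ha hK (@series_deriv1_sigma K).
  have h2 := gw_sum_mark2 q_ge0 IH hP hK (@series_deriv2_sigma K).
  rewrite -(mulrA A) pi_deriv2 mulrA in h2.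
  by apply: eq_has_sum (has_sumD gw_h (has_sumD h1 h2)) => t; rewrite !mulrDl.
pose V := H * rho ^+ K + A / c.
have Vfix : H + (V * (1 - rho ^- K) + A * c^-1 * rho ^- K) = V.
  by apply/esym/(affine_fixpoint _ _ _ _ rK).
have V0 : 0 <= V.
  apply: addr_ge0; first by apply: mulr_ge0 => //; apply/exprn_ge0/ltW/rho_gt0.
  by apply: divr_ge0 => //; exact/ltW/c_gt0.
have fw0 t : 0 <= f t * le_ K.+1 t * weight q t by rewrite !mulr_ge0 ?order_le_ge0.
have [v hv _] : exists2 v, E (fun t => f t * le_ K.+1 t) v & v <= V.
  apply: (has_sum_trunc (h := height)) => // m.
  suff [v hv vV] : exists2 v,
      E (fun t => if (height t <= m)%N then f t * le_ K.+1 t else 0) v & v <= V.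
    by exists v => //; apply: eq_has_sum hv => t; case: ifP; rewrite ?mul0r.
  elim: m => [|m [v hv vV]].
    exists 0 => //; apply: eq_has_sum (has_sum0 R _) => t.
    by rewrite leqNgt height_gt0 mul0r.
  have [] := le_has_sum (f := fun t =>
    (if (height t <= m.+1)%N then f t * le_ K.+1 t else 0) * weight q t) _ _ (step _ _ hv).
  - by move=> t; case: ifP; rewrite ?mul0r.
  - move=> t; rewrite ler_wpM2r //; set a := fun s => if _ then _ else _.
    have a0 s : 0 <= a s by rewrite /a; case: ifP => // _; rewrite mulr_ge0 ?order_le_ge0.
    have fle s : 0 <= f s * le_ K s by rewrite mulr_ge0 ?order_le_ge0.
    have le0 := order_le_ge0 R K; have eq0 := order_eq_ge0 R K.+1.
    case: ifP => [|_]; last by rewrite !addr_ge0 ?mark1_ge0 ?mark2_ge0.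
    rewrite height_leS => /allP hm; rewrite tally_marks ?leq_addr // !lerD2l lerD2r.
    by apply: le_mark1 => // s /hm sm; rewrite /a sm.
  move=> u hu uV; exists u => //; apply: le_trans uV _.
  rewrite -[leRHS]Vfix lerD2l lerD2r ler_wpM2r //.
  by rewrite subr_ge0 invf_le1 ?exprn_gt0 ?rho_gt0 // exprn_ege1 // rho_ge1.
suff -> : H * order_growth J n.+1 = v by [].
have e : v = H + (v * (1 - rho ^- K) + A * c^-1 * rho ^- K).
  apply: (has_sum_unique hv); apply: eq_has_sum (step _ _ hv) => t.
  by rewrite tally_marks // leq_addr.
by move/(affine_fixpoint _ _ _ _ rK): e ->; rewrite /= mulrDr mulrA.
Qed.

End Additive.

(** * Means of the contribution of one vertex *)

(** By is_branch_end_marks this is Q(sigma_J) - sigma_J. *)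
Lemma gw_branch_end J :
  E (fun t => (is_branch_end J.+1 t)%:R) (q0 * c ^- J * rho ^- J).
Proof.
have [hJ _] := gw_order J.
have le t : le_ J t * weight q t <= (\prod_(s <- children t) le_ J s) * weight q t.
  by rewrite ler_wpM2r ?weight_ge0 // -subr_ge0 -is_branch_end_marks.
have := has_sumB le hJ (gw_sum_prod q_ge0 hJ (@series_gf_sigma J)).
rewrite addrAC subrr add0r; apply: eq_has_sum => t.
by rewrite is_branch_end_marks mulrBl.
Qed.

Lemma order_eq_le i K t : eq_ i t * le_ K t = (i <= K)%N%:R * eq_ i t.
Proof.
rewrite /order_eq /order_le -!natrM; congr (_%:R).
by case: eqP => [->|]; rewrite ?muln0 // mulnC.
Qed.

Lemma gw_indicator i K : (0 < i)%N ->
  E (fun t => eq_ i t * le_ K t) ((i <= K)%N%:R * (q0 * c ^- i.-1)).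
Proof.
move=> i0; apply: eq_has_sum (has_sumZ (k := (i <= K)%N%:R) _ (gw_order_eq i0)) => // t.
by rewrite order_eq_le mulrA.
Qed.

Lemma gw_side_children i J : (0 < i <= J)%N ->
  E (fun t => (side_children_of_order i J.+1 t)%:R)
    (q0 * c ^- i.-1 * (c^-1 * rho ^- J)).
Proof.
move=> /andP[i0 iJ]; have [hJ hP] := gw_order J.
have := gw_sum_mark2 q_ge0 (gw_order_eq i0) hP hJ (@series_deriv2_sigma J).
rewrite -mulrA pi_deriv2; apply: eq_has_sum => t; congr (_ * _).
rewrite /side_children_of_order natrM side_child_marks count_child_ordersE.
rewrite mulrC sum_mark1.
have -> : (fun s => eq_ i s * eq_ J.+1 s) = (fun=> 0).
  apply/funext => s; rewrite /order_eq -natrM.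
  by case: eqP => [->|]; rewrite ?mul0n //; case: eqP => // e; move: iJ; rewrite e ltnn.
rewrite mark1_0 add0r; congr (mark2 _ _ _ _); apply/funext => s.
by rewrite order_eq_le iJ mul1r.
Qed.

Lemma gw_children_below i K : (0 < i)%N ->
  E (fun t => (count_mem i (child_orders t))%:R * le_ K.+1 t)
    (q0 * c ^- i.-1 * ((i <= K.+1)%N%:R * (1 - rho ^- K) +
                       (i <= K)%N%:R * (c^-1 * rho ^- K))).
Proof.
move=> i0; have [hK hP] := gw_order K.
have h1 := gw_sum_mark1 q_ge0 (gw_indicator K.+1 i0) hK (@series_deriv1_sigma K).
have h2 := gw_sum_mark2 q_ge0 (gw_indicator K i0) hP hK (@series_deriv2_sigma K).
rewrite -mulrA pi_deriv2 in h2.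
rewrite mulrDr !mulrA [_ * (i <= K.+1)%N%:R]mulrC [_ * (i <= K)%N%:R]mulrC !mulrA.
rewrite !mulrA in h1 h2.
apply: eq_has_sum (has_sumD h1 h2) => t.
by rewrite count_child_ordersE additive_marks mulrDl.
Qed.

(** A difference of two instances of gw_children_below.  The last term is absent
for i = J+1, because the counted child is then itself the one of order J+1. *)
Lemma gw_children i J : (0 < i <= J.+1)%N ->
  E (fun t => (children_of_order i J.+2 t)%:R)
    (q0 * c ^- i.-1 * (rho ^- J - rho ^- J.+1 + c^-1 * rho ^- J.+1 -
                       (i <= J)%N%:R * (c^-1 * rho ^- J))).
Proof.
move=> /andP[i0 iJ].
have h1 := gw_children_below J.+1 i0; have h2 := gw_children_below J i0.
have hE t : (children_of_order i J.+2 t)%:R =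
    (count_mem i (child_orders t))%:R * le_ J.+2 t -
    (count_mem i (child_orders t))%:R * le_ J.+1 t :> R.
  by rewrite order_leS /children_of_order natrM /order_eq; ring.
have le t : (count_mem i (child_orders t))%:R * le_ J.+1 t * weight q t <=
    (count_mem i (child_orders t))%:R * le_ J.+2 t * weight q t.
  by rewrite ler_wpM2r ?weight_ge0 // -subr_ge0 -hE.
have hE' t : (count_mem i (child_orders t))%:R * le_ J.+2 t * weight q t -
    (count_mem i (child_orders t))%:R * le_ J.+1 t * weight q t =
    (children_of_order i J.+2 t)%:R * weight q t by rewrite hE mulrBl.
have := eq_has_sum hE' (has_sumB le h2 h1).
rewrite iJ (leq_trans iJ (leqnSn _)) -mulrBr /= !mul1r.
by congr (gw_sum _ _ (_ * _)); ring.
Qed.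

End Expectations.

(** * From plane trees to unlabeled trees *)

(** Change of variables for a mass function that is the image under p of a
summable family. *)
Lemma esum_fibers (R : realType) (T S : choiceType) (p : T -> S) (g : T -> R)
    (k : S -> R) (A : set S) M v :
  (forall y, 0 <= k y) -> has_sum g M ->
  has_sum (fun x => if p x \in A then k (p x) * g x else 0) v ->
  (\esum_(y in A) ((k y)%:E * (\esum_(x in [set x | p x = y]) (g x)%:E)) = v%:E)%E.
Proof.
move=> k0 gM [_ <-]; have [g0 _] := gM.
have inner y : ((k y)%:E * (\esum_(x in [set x | p x = y]) (g x)%:E) =
    \esum_(x in [set x | p x = y]) (k y * g x)%:E)%E.
  have [w hw _] : exists2 w, has_sum (fun x => if p x == y then g x else 0) w & w <= M.
    by apply: le_has_sum gM => x; case: ifP.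
  have fib (a : T -> R) : \esum_(x in [set x | p x = y]) (a x)%:E =
      \esum_(x in [set: T]) (if p x == y then a x else 0)%:E.
    rewrite esum_mkcond; apply: eq_esum => x _.
    by case: eqP => e; [rewrite mem_set | rewrite memNset].
  rewrite !fib hw.2 -EFinM -(has_sumZ (k0 y) hw).2.
  by apply: eq_esum => x _; case: ifP; rewrite ?mulr0.
under eq_esum do rewrite inner.
rewrite (esum_esum (a := fun y x => (k y * g x)%:E)); last first.
  by move=> y x _ _; rewrite lee_fin mulr_ge0.
rewrite (reindex_esum [set x | A (p x)] _ (fun x => (p x, x))) /=; last first.
  split=> [x /= Ax|x z _ _ []//|[y x] [/= Ay xy]]; first by [].
  by exists x; rewrite /= xy.
rewrite esum_mkcond; apply: eq_esum => x _.
case: ifPn => h; case: ifPn => // h'.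
  by case/negP: h'; apply: mem_set; move/set_mem: h.
by case/negP: h; apply: mem_set; move/set_mem: h'.
Qed.

Section Transfer.
Variables (R : realType) (q : nat -> R).
Hypotheses (q_ge0 : forall n, 0 <= q n) (q1 : q 1%N = 0).

Lemma planar_gw_planted t : planar_gw q (Node [:: t]) = weight q t.
Proof.
rewrite /planar_gw mul1r /weight big_mkcond big_vertices /= mul1r big_seq1.
apply: eq_bigr => v _; rewrite offspring_rcons /is_root -size_eq0 size_rcons.
by [].
Qed.

(** Since q 1 = 0, the weight charges only trees to which the recursive
description of the order applies. *)
Lemma weight_not_branching t : ~~ branching t -> weight q t = 0.
Proof.
rewrite branchingE => /allPn[v vt /negPn/eqP h].
by rewrite /weight (big_rem v) //= h q1 mul0r.
Qed.

Let planted_fun (f : tree -> R) (t : tree) : R :=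
  if t is Node [:: s] then f s * weight q s else 0.

Lemma has_sum_planted f v : gw_sum q f v ->
  has_sum (fun t : ptree => planted_fun f (val t)) v.
Proof.
move=> h; have fw0 t : 0 <= f t * weight q t := h.1 t.
have p0 t : 0 <= planted_fun f t by case: t => -[|s []] //=.
apply: (iffRL (has_sum_inj (e := val) v _ _ _)) => //.
- case=> -[|s []] // nt /=.
  have [bs|nbs] := boolP (branching s); last by rewrite weight_not_branching ?mulr0.
  have ps : planted (Node [:: s]) && reduced (Node [:: s]) by rewrite reduced_planted.
  by case: (nt (exist _ (Node [:: s]) ps)).
apply: (iffLR (has_sum_inj (e := fun s => Node [:: s]) v _ _ _)) => //.
- by move=> x y [].
- by case=> -[|s []] // nt; case: (nt s).
Qed.

Lemma iso_planted_inv x s : iso x (Node [:: s]) ->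
  exists2 s', x = Node [:: s'] & iso s' s.
Proof.
move=> /iso_inv[n [p [zx zs h]]]; case: n p zx zs h => [|[|n]] // p zx _ h.
case: x zx h => -[|s' []] //= _ h.
by exists s' => //; have := h ord0; rewrite (ord1 (p ord0)).
Qed.

(** The value of f on an unlabeled tree is computed on an arbitrary
representative; as F is invariant, the plane tree being summed will do. *)
Lemma esum_GW (f : tree -> nat) (F : tree -> nat) K M v :
  (forall t, branching t -> f (Node [:: t]) = F t) -> iso_invariant F ->
  gw_sum q (fun=> 1) M -> gw_sum q (fun t => (F t)%:R * order_eq R K t) v ->
  (\esum_(x in [set x : utree | ord x = K]) ((f (x : utree))%:R%:E * GW q x) = v%:E)%E.
Proof.
move=> fF iF hM hv.
have gE (t : ptree) : planar_gw q (val t) = planted_fun (fun=> 1) (val t).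
  case: t => -[[|s []]] //= ht; first by rewrite /planar_gw mul0r.
  by rewrite planar_gw_planted mul1r.
have hg : has_sum (fun t : ptree => planar_gw q (val t)) M.
  by apply: eq_has_sum (has_sum_planted hM) => t; rewrite gE.
apply: (esum_fibers (k := fun x : utree => (f x)%:R) _ hg) => //.
apply: eq_has_sum (has_sum_planted hv) => t.
have iso_t : iso (\pi_utree%qT t : utree) (val t).
  have : isob (repr (\pi_utree%qT t)) t by apply/eqmodP; rewrite reprK.
  by move/asboolP.
have red_t : reduced (\pi_utree%qT t : utree).
  by rewrite /Defs.tree_of; case/andP: (valP (repr (\pi_utree%qT t))).
move: (\pi_utree%qT t) iso_t red_t => x.
case: t => -[[|s []]] //= ht it rt.
  by rewrite /planar_gw mul0r mulr0 if_same.
have [s' e is'] := iso_planted_inv it.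
rewrite planar_gw_planted /order_eq.
have bs' : branching s' by rewrite -reduced_planted -e.
have ox : ord (Defs.tree_of x) = order s by rewrite e ord_planted // (iso_order is').
have -> : f (Defs.tree_of x) = F s by rewrite e fF // (iF _ _ is').
case: eqP => ho; [rewrite mem_set | rewrite memNset] => //=.
- by rewrite mulr1.
- by rewrite ox.
- by rewrite mulr0 mul0r.
- by rewrite ox.
Qed.

End Transfer.

(** * Ratios of conditional means *)

Section Ratios.
Variables (R : realType) (q0 : R) (q : nat -> R).
Hypotheses (q0_bounds : 2^-1 <= q0 < 1) (q_ge0 : forall n, 0 <= q n).
Hypothesis q1 : q 1%N = 0.
Hypothesis gf : generating_function q (fun z => z + q0 * (1 - z) `^ q0^-1).

Local Notation c := ((1 - q0)^-1).
Local Notation rho := (c `^ (c - 1)^-1).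
Local Notation mu := (GW q).

Let cgt0 : 0 < c := c_gt0 q0_bounds.
Let cge2 : 2 <= c := c_ge2 q0_bounds.
Let rgt0 : 0 < rho := rho_gt0 q0_bounds.

Lemma order_prob_GW i : (0 < i)%N -> order_prob mu i = (q0 * c ^- i.-1)%:E.
Proof.
move=> i0; have [M hM _] := gw_total q0_bounds q_ge0 gf.
have h := gw_order_eq q0_bounds q_ge0 q1 gf i0.
have hF : gw_sum q (fun t => 1%N%:R * order_eq R i t) (q0 * c ^- i.-1).
  by apply: eq_has_sum h => t; rewrite mul1r.
rewrite /order_prob.
rewrite -(esum_GW q1 (f := fun=> 1%N) (F := fun=> 1%N) _ _ hM hF) //.
by apply: eq_esum => x _; rewrite mul1e.
Qed.

Lemma rho_gt1 : 1 < rho.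
Proof.
have e0 : 0 < (c - 1)^-1 by rewrite invr_gt0 c1_gt0.
have := gt0_ltr_powR e0 (x := 1) (y := c); rewrite powR1; apply.
- by rewrite nnegrE.
- by rewrite nnegrE ltW.
- by have := cge2; lra.
Qed.

Lemma order_growthE J n : order_growth q0 J n =
  c * rho ^+ J * (rho ^+ n - c ^- n) / (c * rho - 1).
Proof.
have R1 : c * rho - 1 != 0.
  by apply: lt0r_neq0; have := rho_gt1; have := cge2; nra.
have c0 := lt0r_neq0 cgt0.
elim: n => [|n IH] /=; first by rewrite !expr0 invr1 subrr mulr0 mul0r.
rewrite {}IH exprD !exprS; have cn : c ^+ n != 0 by rewrite expf_neq0.
move: (c ^+ n) cn (rho ^+ n) (rho ^+ J) (rho) R1; move: c c0.
move=> d hd s hs r u p hp.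
by field; rewrite hd hs hp.
Qed.

(** The difference isolates the trees of order exactly J + n + 1. *)
Lemma order_growth_step J n :
  order_growth q0 J n.+1 - order_growth q0 J n =
  rho ^+ J * (rho ^+ n * (c * rho - c) + (c - 1) * c ^- n) / (c * rho - 1).
Proof.
have R1 : c * rho - 1 != 0.
  by apply: lt0r_neq0; have := rho_gt1; have := cge2; nra.
have c0 := lt0r_neq0 cgt0.
rewrite !order_growthE !exprS; have cn : c ^+ n != 0 by rewrite expf_neq0.
move: (c ^+ n) cn (rho ^+ n) (rho ^+ J) (rho) R1; move: c c0.
move=> d hd s hs r u p hp.
by field; rewrite hd hs hp.
Qed.

Lemma order_growth_step_gt0 J n :
  0 < order_growth q0 J n.+1 - order_growth q0 J n.
Proof.
have R1 : 0 < c * rho - 1 by have := rho_gt1; have := cge2; nra.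
rewrite order_growth_step divr_gt0 // mulr_gt0 ?exprn_gt0 // ltr_wpDl //.
  rewrite mulr_ge0 ?exprn_ge0 ?(ltW rgt0) // subr_ge0 ler_peMr ?(ltW cgt0) //.
  exact/ltW/rho_gt1.
by rewrite mulr_gt0 ?(c1_gt0 q0_bounds) // (tail_gt0 q0_bounds).
Qed.

Section Stat.
Variables (f h : tree -> nat) (J : nat) (H : R).
Hypothesis h_order : forall t, h t != 0%N -> order t = J.+1.
Hypothesis gw_h : gw_sum q (fun t => (h t)%:R) H.
Hypothesis h_iso : iso_invariant h.
Hypothesis f_tally : forall t, branching t -> f (Node [:: t]) = tally h t.

Lemma cond_mean_tally n : cond_mean mu (J + n).+1 f =
  (H * (order_growth q0 J n.+1 - order_growth q0 J n) / (q0 * c ^- (J + n)))%:E.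
Proof.
have [M hM _] := gw_total q0_bounds q_ge0 gf.
have h1 := gw_additive q0_bounds q_ge0 q1 gf h_order gw_h n.+1.
have h0 := gw_additive q0_bounds q_ge0 q1 gf h_order gw_h n.
have w0 t : 0 <= weight q t by exact: weight_ge0.
rewrite addnS in h1; set K := (J + n)%N in h0 h1 *.
have le t : (tally h t)%:R * order_le R K t * weight q t <=
    (tally h t)%:R * order_le R K.+1 t * weight q t.
  by rewrite ler_wpM2r // ler_wpM2l ?ler0n // order_leS lerDl order_eq_ge0.
have hE t : (tally h t)%:R * order_le R K.+1 t * weight q t -
    (tally h t)%:R * order_le R K t * weight q t =
    (tally h t)%:R * order_eq R K.+1 t * weight q t.
  by rewrite order_leS; ring.
have := eq_has_sum hE (has_sumB le h0 h1); rewrite -mulrBr => hv.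
rewrite /cond_mean (esum_GW q1 f_tally (iso_tally h_iso) hM hv).
rewrite order_prob_GW // inver ifF ?EFinM //; apply/negbTE/lt0r_neq0.
by rewrite mulr_gt0 ?(q0_gt0 q0_bounds) ?(tail_gt0 q0_bounds).
Qed.

End Stat.

(** The order K = J + n + 1 enters both means only through the common factor
order_growth (n + 1) - order_growth n and the probability of order K. *)
Lemma cond_mean_ratio (f g h k : tree -> nat) J (H1 H2 : R) n :
  (forall t, h t != 0%N -> order t = J.+1) ->
  (forall t, k t != 0%N -> order t = J.+1) ->
  gw_sum q (fun t => (h t)%:R) H1 -> gw_sum q (fun t => (k t)%:R) H2 ->
  iso_invariant h -> iso_invariant k ->
  (forall t, branching t -> f (Node [:: t]) = tally h t) ->
  (forall t, branching t -> g (Node [:: t]) = tally k t) -> 0 < H2 ->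
  (cond_mean mu (J + n).+1 f / cond_mean mu (J + n).+1 g)%E = (H1 / H2)%:E.
Proof.
move=> ho ko hH kH hi ki fh gk H20.
rewrite (cond_mean_tally ho hH hi fh) (cond_mean_tally ko kH ki gk).
have D0 := order_growth_step_gt0 J n.
have p0 : 0 < q0 * c ^- (J + n).
  by rewrite mulr_gt0 ?(q0_gt0 q0_bounds) ?(tail_gt0 q0_bounds).
rewrite inver ifF; last first.
  by apply/negbTE/lt0r_neq0; rewrite divr_gt0 // mulr_gt0.
rewrite -EFinM; congr (_%:E).
move: (_ - _) (q0 * _) D0 p0 => D p /lt0r_neq0 hD /lt0r_neq0 hp.
by field; rewrite hD hp (lt0r_neq0 H20).
Qed.

Lemma is_branch_end_order j t : is_branch_end j t != 0%N -> order t = j.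
Proof. rewrite /is_branch_end; by case: (order t =P j). Qed.

Lemma children_of_order_order i j t : children_of_order i j t != 0%N -> order t = j.
Proof. by rewrite /children_of_order; case: (order t =P j). Qed.

Lemma side_children_of_order_order i j t :
  side_children_of_order i j t != 0%N -> order t = j.
Proof. by rewrite /side_children_of_order; case: (order t =P j). Qed.

Lemma branch_end_mass_gt0 J : 0 < q0 * c ^- J * rho ^- J.
Proof.
rewrite !mulr_gt0 ?(q0_gt0 q0_bounds) ?(tail_gt0 q0_bounds) //.
by rewrite invr_gt0 exprn_gt0.
Qed.

Lemma regular_tokunaga_GW i j : (1 <= i < j)%N ->
  regular_tokunaga_coef mu i j (c ^+ (j - i).-1).
Proof.
case: j => [|J] /andP[i0 iJ] // K JK.
rewrite /regular_tokunaga_ratio -(subnKC JK) addSn.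
rewrite (@cond_mean_ratio _ _ (side_children_of_order i J.+1) (is_branch_end J.+1)
  J (q0 * c ^- i.-1 * (c^-1 * rho ^- J)) (q0 * c ^- J * rho ^- J)) //.
- congr (_%:E); case: i i0 iJ => // i _ iJ /=.
  have -> : c ^+ J = c ^+ (J.+1 - i.+1).-1 * c * c ^+ i.
    by rewrite -exprSr -exprD; congr (_ ^+ _); lia.
  have c0 := lt0r_neq0 cgt0; have r0 : rho ^+ J != 0 by rewrite expf_neq0 ?lt0r_neq0.
  have q00 := lt0r_neq0 (q0_gt0 q0_bounds).
  have cn k : c ^+ k != 0 by rewrite expf_neq0.
  move: (rho ^+ J) r0 (c ^+ i) (cn i) (c ^+ _) (cn (J.+1 - i.+1).-1) => r hr s hs u hu.
  move: c c0 => d hd.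
  by field; rewrite ?hr ?hs ?hu ?hd ?q00.
- exact: side_children_of_order_order.
- exact: is_branch_end_order.
- by apply: gw_side_children; rewrite ?i0.
- exact: gw_branch_end.
- exact: iso_side_children_of_order.
- exact: iso_is_branch_end.
- by move=> t bt; apply: num_side_regular_tally.
- by move=> t bt; apply: num_branches_tally.
- exact: branch_end_mass_gt0.
Qed.

Lemma tokunaga_GW i j : (1 <= i < j)%N ->
  tokunaga_coef mu i j
    (if (j - i == 1)%N then c * rho - c - 1
     else (c - 1) * (rho - 1) * c ^+ (j - i).-1).
Proof.
case: j => [|[|J]] /andP[i0 iJ] //; first by case: i i0 iJ.
move=> K JK.
rewrite /tokunaga_ratio -(subnKC JK) addSn.
rewrite (@cond_mean_ratio _ _ (children_of_order i J.+2) (is_branch_end J.+2)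
  J.+1 (q0 * c ^- i.-1 * (rho ^- J - rho ^- J.+1 + c^-1 * rho ^- J.+1 -
                       (i <= J)%N%:R * (c^-1 * rho ^- J)))
  (q0 * c ^- J.+1 * rho ^- J.+1)) //.
- rewrite -EFinB; congr (_%:E).
  have c0 := lt0r_neq0 cgt0; have r0 : rho ^+ J != 0 by rewrite expf_neq0 ?lt0r_neq0.
  have q00 := lt0r_neq0 (q0_gt0 q0_bounds); have rh0 := lt0r_neq0 rgt0.
  have cn k : c ^+ k != 0 by rewrite expf_neq0.
  case: i i0 iJ => // i _ iJ /=; rewrite ltnS in iJ.
  rewrite -[J.+2]/(J.+1.+1) subSS eqSS.
  have [iJ'|Ji] := ltnP i J; last first.
    have -> : i = J by lia.
    rewrite subSnn !eqxx mul0r subr0 mulr1 !exprS.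
    move: (c ^+ J) (cn J) (rho ^+ J) r0 => s hs r hr.
    move: (rho) rh0 => p hp; move: c c0 => d hd.
    by field; rewrite ?hr ?hs ?hd ?q00 ?hp.
  have -> : (J.+1 - i == 1)%N = false by lia.
  have -> : (i == J) = false by lia.
  have -> : (J.+1 - i).-1 = (J - i)%N by lia.
  rewrite mulr0 subr0 mul1r !exprS -[in c ^+ J](subnK (ltnW iJ')) exprD.
  move: (c ^+ (J - i)) (cn (J - i)%N) (c ^+ i) (cn i) (rho ^+ J) r0.
  move=> u hu s hs r hr.
  move: (rho) rh0 => p hp; move: c c0 => d hd.
  by field; rewrite ?hr ?hs ?hd ?q00 ?hp ?hu.
- exact: children_of_order_order.
- exact: is_branch_end_order.
- by apply: gw_children; rewrite ?i0.
- exact: gw_branch_end.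
- exact: iso_children_of_order.
- exact: iso_is_branch_end.
- by move=> t bt; apply: num_side_tally.
- by move=> t bt; apply: num_branches_tally.
- exact: branch_end_mass_gt0.
Qed.

(** The mean of is_branch_end (J+1) is q0 (c rho)^(-J), and the growth from order
J+1 to order m+1 involves rho^m and c^(-(m-J)); dividing by rho^m leaves powers
of c rho. *)
Lemma horton_ratio J m : (J <= m)%N ->
  (cond_mean mu m.+1 (fun t => num_branches t J.+1) /
   cond_mean mu m.+1 (fun t => num_branches t 1))%E =
  (((c * rho) ^- J * (c * rho - c) + (c - 1) * (c * rho) ^- m) /
   ((c * rho - c) + (c - 1) * (c * rho) ^- m))%:E.
Proof.
move=> Jm.
have h k n : cond_mean mu (k + n).+1 (fun t => num_branches t k.+1) = _ :=
  cond_mean_tally (@is_branch_end_order k.+1) (gw_branch_end q0_bounds q_ge0 q1 gf k)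
    (@iso_is_branch_end k.+1) (fun t bt => num_branches_tally k.+1 bt) n.
have {Jm}[n ->] : exists n, m = (J + n)%N by exists (m - J)%N; rewrite subnKC.
rewrite (h J n) -[(J + n).+1 in X in (_ / X)%E]add0n addnS (h 0%N (J + n)%N) add0n {h}.
have R1 : c * rho - 1 != 0.
  by apply: lt0r_neq0; have := rho_gt1; have := cge2; nra.
have Rc : 0 < c * rho - c by have := rho_gt1; have := cge2; nra.
have c1 : 0 < c - 1 by exact: c1_gt0.
have q00 := lt0r_neq0 (q0_gt0 q0_bounds).
pose Y := (c * rho) ^+ (J + n) / (c * rho - 1).
have XE k l : (k + l = J + n)%N ->
    q0 * c ^- k * rho ^- k * (order_growth q0 k l.+1 - order_growth q0 k l) /
    (q0 * c ^- (J + n)) =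
    Y * ((c * rho) ^- k * (c * rho - c) + (c - 1) * (c * rho) ^- (J + n)).
  rewrite /Y => <-; rewrite order_growth_step !exprMn !exprD.
  have cn a : c ^+ a != 0 by rewrite expf_neq0 // lt0r_neq0.
  have rn a : rho ^+ a != 0 by rewrite expf_neq0 // lt0r_neq0.
  move: (c ^+ k) (cn k) (c ^+ l) (cn l) (rho ^+ k) (rn k) (rho ^+ l) (rn l).
  move=> s hs u hu r hr w hw; move: (rho) R1 {Rc} => p.
  move: c (lt0r_neq0 cgt0) {c1 cn} => d hd R1.
  by field; rewrite hw hr hu hs R1 q00.
rewrite (XE J n erefl) (XE 0%N (J + n)%N erefl) expr0 invr1 mul1r.
have Y0 : Y != 0.
  by rewrite mulf_neq0 ?invr_eq0 // expf_neq0 // mulf_neq0 ?lt0r_neq0.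
have B0 : (c * rho - c) + (c - 1) * (c * rho) ^- (J + n) != 0.
  apply: lt0r_neq0; rewrite addr_gt0 // mulr_gt0 // invr_gt0 exprn_gt0 //.
  by rewrite mulr_gt0.
rewrite inver ifF; last by apply/negbTE; rewrite mulf_neq0.
by rewrite -EFinM; congr (_%:E); rewrite invfM mulrACA divff // mul1r.
Qed.

Lemma strong_horton_GW : strong_horton mu (c * rho).
Proof.
have r1 := rho_gt1; have c2 := cge2.
have R2 : 2 <= c * rho by nra.
split=> // k k0; case: k k0 => // J _ /=.
rewrite -cvg_shiftS /=.
pose u m : R := ((c * rho) ^- J * (c * rho - c) + (c - 1) * (c * rho) ^- m) /
   ((c * rho - c) + (c - 1) * (c * rho) ^- m).
have Rc : c * rho - c != 0 by apply: lt0r_neq0; nra.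
have geo : (fun m => (c * rho) ^- m) @ \oo --> (0 : R).
  rewrite (_ : (fun m => _) = GRing.exp (c * rho)^-1); last first.
    by apply/funext => m; rewrite exprVn.
  apply: cvg_expr; rewrite ger0_norm ?invr_ge0; last by lra.
  by rewrite invf_lt1; lra.
have num : (fun m => (c - 1) * (c * rho) ^- m) @ \oo --> (0 : R).
  by rewrite -[X in _ --> X](mulr0 (c - 1)); apply: cvgM geo; exact: cvg_cst.
have uR : u @ \oo --> (c * rho) ^- J.
  have -> : (c * rho) ^- J =
      ((c * rho) ^- J * (c * rho - c) + 0) / ((c * rho - c) + 0).
    by rewrite !addr0 mulfK.
  apply: cvgM; first by apply: cvgD num; exact: cvg_cst.
  apply: cvgV; first by rewrite addr0.
  by apply: cvgD num; exact: cvg_cst.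
apply: (cvg_trans _ (_ : (EFin \o u) @ \oo --> ((c * rho) ^- J)%:E)); last first.
  by apply: cvg_EFin => //; apply: nearW.
apply: near_eq_cvg; exists J => // m /= Jm.
by rewrite horton_ratio.
Qed.

(** From ln c >= 1 - 1/c and exp x >= 1 + x one gets rho >= 1 + 1/c. *)
Lemma tokunaga1_ge0 : 0 <= c * rho - c - 1.
Proof.
have c2 := cge2; have c0 := lt0r_neq0 cgt0.
have lnc : 1 - c^-1 <= ln c.
  have cV : 0 < c^-1 by rewrite invr_gt0.
  have h : ln (1 + (c^-1 - 1)) <= c^-1 - 1 by apply: le_ln1Dx; lra.
  by move: h; rewrite addrC subrK lnV ?posrE //; lra.
have : 1 + c^-1 <= rho.
  rewrite /powR (negbTE c0); apply: le_trans (expR_ge1Dx _) _.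
  rewrite ler_expR ler_pdivlMl; last exact: c1_gt0.
  apply: le_trans lnc.
  by rewrite mulrBl mul1r divff.
have : c * c^-1 = 1 by rewrite divff.
have := cgt0; nra.
Qed.

Lemma toeplitz_GW : toeplitz mu.
Proof.
exists (fun k => if (k == 1)%N then c * rho - c - 1
                 else (c - 1) * (rho - 1) * c ^+ k.-1).
split=> [k _|i j ij]; last exact: tokunaga_GW.
have r1 := rho_gt1; have c2 := cge2.
case: ifP => _; first exact: tokunaga1_ge0.
by rewrite !mulr_ge0 ?exprn_ge0 ?(ltW cgt0) //; lra.
Qed.

End Ratios.

Theorem lemma10 (R : realType) (q0 : R) (mu : utree -> \bar R)
    (hq0 : 2^-1 <= q0 < 1) (hmu : IGW q0 mu) :
  let c : R := (1 - q0)^-1 in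
  let a : R := (c - 1) * (c `^ (c - 1)^-1 - 1) in
  let r : R := c `^ (c / (c - 1)) in
  [/\ forall i, (1 <= i)%N -> order_prob mu i = (q0 * c ^- i.-1)%:E,
      toeplitz mu,
      forall i j, (1 <= i < j)%N ->
        regular_tokunaga_coef mu i j (c ^+ (j - i).-1),
      forall i j, (1 <= i < j)%N ->
        tokunaga_coef mu i j
          (if (j - i == 1)%N then c `^ (c / (c - 1)) - c - 1
           else a * c ^+ (j - i).-1) &
      strong_horton mu r /\ r = (1 - q0) `^ (- q0^-1)].
Proof.
have [q [[q_ge0 q1 _] _ gf ->]] := hmu.
move=> c a r; rewrite /r /a /c !(rhoE hq0); split.
- exact: order_prob_GW.
- exact: (toeplitz_GW hq0 q_ge0 q1 gf).
- exact: regular_tokunaga_GW.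
- exact: tokunaga_GW.
split; first exact: strong_horton_GW.
rewrite -(rhoE hq0) -(q0V hq0) -{1}[1 - q0]powRr1; last by case/andP: hq0 => _; lra.
by rewrite -powR_inv1 ?powRr1 -?powRrM ?mulN1r //; case/andP: hq0 => _; lra.
Qed.
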